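(* Let $(B,\psi)$ be a finite quantum space with $\delta$-form $\psi$, let $K=K(B,\psi)$ be the complete quantum graph, and let $E_K$ be its quantum edge correspondence. Then the Cuntz--Pimsner algebra $\mathcal{O}_{E_K}$ is isomorphic to the Cuntz algebra $\mathcal{O}_n$, where $n=\dim B$.
   Context: A finite quantum space $(B,\psi)$ is a finite-dimensional C*-algebra $B$ with a faithful state $\psi$ that is a $\delta$-form, $\delta>0$: if $m\colon B\otimes B\to B$ is multiplication and $m^*\colon B\to B\otimes B$ is its adjoint with respect to the inner products $\langle x,y\rangle_\psi=\psi(x^*y)$ on $B$ and $\langle\cdot,\cdot\rangle_{\psi\otimes\psi}$ on $B\otimes B$, then $mm^*=\delta^2\,\mathrm{id}_B$. A quantum graph $\mathcal{G}=(B,\psi,A)$ is such a space with a linear map $A\colon B\to B$ satisfying $m(A\otimes A)m^*=\delta^2A$. The complete quantum graph is $K(B,\psi)=(B,\psi,A)$ with $A=\delta^2\psi(\cdot)1_B$. A C*-correspondence over $B$ is a right Hilbert $B$-module $X$ with a $*$-homomorphism $\varphi_X\colon B\to\mathcal{L}(X)$ into the adjointable operators; write $x\cdot\xi=\varphi_X(x)\xi$. $B\otimes_\psi B$ is the C*-correspondence over $B$ with underlying space $B\otimes B$, actions $x\cdot(a\otimes b)\cdot y=(xa)\otimes(by)$ and inner product $\langle a\otimes b,c\otimes d\rangle_B=b^*\psi(a^*c)d$. The quantum edge correspondence of $\mathcal{G}$ is the subcorrespondence $E_{\mathcal{G}}=\mathrm{span}\{x\cdot\epsilon_{\mathcal{G}}\cdot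 y: x,y\in B\}$ of $B\otimes_\psi B$, where $\epsilon_{\mathcal{G}}=\frac{1}{\delta^2}(\mathrm{id}\otimes A)m^*(1_B)$. A representation of a C*-correspondence $X$ over $B$ on a C*-algebra $D$ is a pair $(\pi,t)$ with $\pi\colon B\to D$ a $*$-homomorphism and $t\colon X\to D$ linear such that $\pi(x)t(\xi)=t(x\cdot\xi)$ and $t(\xi)^*t(\eta)=\pi(\langle\xi,\eta\rangle_B)$. With $\theta_{\xi,\eta}(\zeta)=\xi\cdot\langle\eta,\zeta\rangle_B$ generating the compact operators $\mathcal{K}(X)$, let $\psi_t\colon\mathcal{K}(X)\to D$ be the $*$-homomorphism with $\psi_t(\theta_{\xi,\eta})=t(\xi)t(\eta)^*$. The representation is covariant if $\pi(x)=\psi_t(\varphi_X(x))$ for all $x\in J_X=\{x\in B:\varphi_X(x)\in\mathcal{K}(X),\ xy=0\ \forall y\in\ker\varphi_X\}$. The Cuntz--Pimsner algebra is $\mathcal{O}_X=C^*(\pi_X(B),t_X(X))$ where $(\pi_X,t_X)$ is the universal covariant representation. The Cuntz algebra $\mathcal{O}_n$ is the universal unital C*-algebra generated by $n$ isometries whose range projections sum to $1$ (for $n=1$ this is $C(\mathbb{T})$). *)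

(* Defs.v *)
From HB Require Import structures.
From mathcomp Require Import all_boot all_order all_algebra.
From mathcomp Require Import complex ring lra spectral.
From mathcomp Require Import boolp classical_sets reals topology normedtype derive.

Set Implicit Arguments.
Unset Strict Implicit.
Unset Printing Implicit Defensive.

Import Order.TTheory GRing.Theory Num.Theory numFieldNormedType.Exports.
Import VectorInternalTheory.

Local Open Scope classical_set_scope.
Local Open Scope ring_scope.

(* C*-algebras need not be unital.  The norm takes its values in R[i], as for  *)
(* any normedModType over R[i].                                               *)
HB.mixin Record isCStarAlgebra (R : realType) A
    of CompleteNormedModule R[i] A := {
  cmul : A -> A -> A;
  cstar : A -> A;
  cmulA : associative cmul;
  cmul_linl : forall (a : R[i]) (x y z : A),
    cmul (a *: x + y) z = a *: cmul x z + cmul y z;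
  cmul_linr : forall (a : R[i]) (x y z : A),
    cmul z (a *: x + y) = a *: cmul z x + cmul z y;
  cstar_antilin : forall (a : R[i]) (x y : A),
    cstar (a *: x + y) = a^* *: cstar x + cstar y;
  cstarK : involutive cstar;
  cstarM : forall x y : A, cstar (cmul x y) = cmul (cstar y) (cstar x);
  cnormM : forall x y : A, `|cmul x y| <= `|x| * `|y|;
  cnorm_star : forall x : A, `|cmul (cstar x) x| = `|x| ^+ 2 }.

#[short(type="cstarType")]
HB.structure Definition CStarAlgebra (R : realType) :=
  {A of isCStarAlgebra R A & CompleteNormedModule R[i] A}.

HB.mixin Record hasCOne (R : realType) A of CStarAlgebra R A := {
  cone : A;
  cmul1 : right_id cone (@cmul R A);
  c1mul : left_id cone (@cmul R A) }.

#[short(type="unitalCstarType")]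
HB.structure Definition UnitalCStarAlgebra (R : realType) :=
  {A of hasCOne R A & CStarAlgebra R A}.

(* A finite-dimensional C*-algebra always has a unit. *)
#[short(type="fdCstarType")]
HB.structure Definition FinDimCStarAlgebra (R : realType) :=
  {A of UnitalCStarAlgebra R A & Vector R[i] A}.

Declare Scope cstar_scope.
Delimit Scope cstar_scope with cs.
Local Open Scope cstar_scope.
Notation "x ∙ y" := (cmul x y) (at level 40, left associativity) : cstar_scope.
Notation "x ^†" := (cstar x) (at level 2, format "x ^†") : cstar_scope.

Section CStarDefs.
Variable R : realType.

Definition starhom (A D : cstarType R) (f : A -> D) : Prop :=
  [/\ forall (a : R[i]) x y, f (a *: x + y) = a *: f x + f y,
      forall x y, f (x ∙ y) = f x ∙ f y
    & forall x, f (x^†) = (f x)^†].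

(* The inverse of a bijective *-homomorphism is a *-homomorphism. *)
Definition star_isomorphic (A D : cstarType R) : Prop :=
  exists2 f : A -> D, starhom f & bijective f.

(* A = C*(S) *)
Definition generates (A : cstarType R) (S : set A) : Prop :=
  forall H : set A, closed H -> S `<=` H -> H 0 ->
    (forall (a : R[i]) x y, H x -> H y -> H (a *: x + y)) ->
    (forall x y, H x -> H y -> H (x ∙ y)) ->
    (forall x, H x -> H (x^†)) ->
  H = setT.

(* In a C*-algebra a sum of elements y^* y is again of this form, so these    *)
(* are the positive elements.                                                 *)
Definition cpositive (A : cstarType R) (x : A) : Prop :=
  exists s : seq A, x = \sum_(y <- s) y^† ∙ y.

End CStarDefs.

Section Correspondences.
Variable R : realType.

Definition hilbert_norm (B : cstarType R) (X : Type) (ip : X -> X -> B)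
    (xi : X) : R[i] := sqrtC `|ip xi xi|.

Record correspondence (B : cstarType R) := Correspondence {
  corr_sort :> lmodType R[i];
  lact : B -> corr_sort -> corr_sort;
  ract : corr_sort -> B -> corr_sort;
  ip : corr_sort -> corr_sort -> B;
  ract_linl : forall (a : R[i]) xi eta b,
    ract (a *: xi + eta) b = a *: ract xi b + ract eta b;
  ract_linr : forall (a : R[i]) xi b c,
    ract xi (a *: b + c) = a *: ract xi b + ract xi c;
  ractM : forall xi b c, ract xi (b ∙ c) = ract (ract xi b) c;
  ip_linr : forall (a : R[i]) xi eta zeta,
    ip xi (a *: eta + zeta) = a *: ip xi eta + ip xi zeta;
  ip_ract : forall xi eta b, ip xi (ract eta b) = ip xi eta ∙ b;
  ip_star : forall xi eta, (ip xi eta)^† = ip eta xi;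
  ip_pos : forall xi, cpositive (ip xi xi);
  ip_def : forall xi, ip xi xi = 0 -> xi = 0;
  hilbert_complete : forall u : nat -> corr_sort,
    (forall e : R[i], 0 < e -> exists N, forall m n,
       (N <= m)%N -> (N <= n)%N -> hilbert_norm ip (u m - u n) < e) ->
    exists l, forall e : R[i], 0 < e -> exists N, forall n,
       (N <= n)%N -> hilbert_norm ip (u n - l) < e;
  lact_linl : forall (a : R[i]) b c xi,
    lact (a *: b + c) xi = a *: lact b xi + lact c xi;
  lact_linr : forall (a : R[i]) b xi eta,
    lact b (a *: xi + eta) = a *: lact b xi + lact b eta;
  lactM : forall b c xi, lact (b ∙ c) xi = lact b (lact c xi);
  lact_adj : forall b xi eta, ip (lact b xi) eta = ip xi (lact (b^†) eta) }.

Variables (B : cstarType R) (X : correspondence B).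
Implicit Types (xi eta zeta : X) (T S : X -> X).

Definition adjoint_pair T S : Prop :=
  forall xi eta, ip (T xi) eta = ip xi (S eta).

Definition theta xi eta : X -> X := fun zeta => ract xi (ip eta zeta).

Definition finite_rank T : Prop :=
  exists s : seq (X * X), T = fun zeta => \sum_(p <- s) theta p.1 p.2 zeta.

(* K(X): the closure of the finite rank operators in L(X) *)
Definition compact_op T : Prop :=
  (exists S, adjoint_pair T S) /\
  forall e : R[i], 0 < e -> exists2 F, finite_rank F &
    forall xi, hilbert_norm (@ip _ X) (T xi - F xi)
               <= e * hilbert_norm (@ip _ X) xi.

Definition katsura_ideal (x : B) : Prop :=
  compact_op (lact x) /\
  forall y : B, (forall xi, lact y xi = 0) -> x ∙ y = 0.

Definition representation (D : cstarType R) (pi : B -> D) (t : X -> D) : Prop :=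
  [/\ starhom pi,
      forall (a : R[i]) xi eta, t (a *: xi + eta) = a *: t xi + t eta,
      forall x xi, pi x ∙ t xi = t (lact x xi)
    & forall xi eta, (t xi)^† ∙ t eta = pi (ip xi eta)].

(* Psi restricts to the *-homomorphism psi_t on K(X); its values at           *)
(* non-compact operators are irrelevant.                                      *)
Definition compact_hom (D : cstarType R) (t : X -> D) (Psi : (X -> X) -> D) :
    Prop :=
  [/\ forall (a : R[i]) T S, compact_op T -> compact_op S ->
        Psi (fun xi => a *: T xi + S xi) = a *: Psi T + Psi S,
      forall T S, compact_op T -> compact_op S -> Psi (T \o S) = Psi T ∙ Psi S,
      forall T S, compact_op T -> compact_op S -> adjoint_pair T S ->
        Psi S = (Psi T)^†
    & forall xi eta, Psi (theta xi eta) = t xi ∙ (t eta)^†].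

Definition covariant (D : cstarType R) (pi : B -> D) (t : X -> D) : Prop :=
  exists2 Psi, compact_hom t Psi &
    forall x, katsura_ideal x -> pi x = Psi (lact x).

(* The uniqueness of rho follows from the generation by the two ranges. *)
Definition universal_covariant (O : cstarType R) (piX : B -> O) (tX : X -> O) :
    Prop :=
  [/\ representation piX tX, covariant piX tX,
      generates (range piX `|` range tX)
    & forall (D : cstarType R) (pi : B -> D) (t : X -> D),
        representation pi t -> covariant pi t ->
        exists rho : O -> D,
          [/\ starhom rho, forall x, rho (piX x) = pi x
            & forall xi, rho (tX xi) = t xi]].

Definition cuntz_pimsner_algebra (O : cstarType R) : Prop :=
  exists (piX : B -> O) (tX : X -> O), universal_covariant piX tX.

End Correspondences.

Section Cuntz.
Variables (R : realType) (n : nat).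

(* For n = 1 the family is a single unitary and the universal algebra C(T). *)
Definition cuntz_family (D : unitalCstarType R) (s : 'I_n -> D) : Prop :=
  (forall i, (s i)^† ∙ s i = cone) /\ \sum_(i < n) s i ∙ (s i)^† = cone.

Definition universal_cuntz_family (C : unitalCstarType R) (s : 'I_n -> C) :
    Prop :=
  [/\ cuntz_family s, generates (cone |` range s)
    & forall (D : unitalCstarType R) (d : 'I_n -> D), cuntz_family d ->
        exists rho : C -> D,
          [/\ starhom rho, rho cone = cone & forall i, rho (s i) = d i]].

Definition cuntz_algebra (C : unitalCstarType R) : Prop :=
  exists s : 'I_n -> C, universal_cuntz_family s.

End Cuntz.

Section Tensor.
Variable K : fieldType.

(* V ⊗ W is realized by the matrices of coordinates of its elements in the    *)
(* basis [tens (tbasis V i) (tbasis W j)].  [tlift] and the lemmas [tlift_tens]*)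
(* and [tens_expand] below are its universal property.                        *)
Definition tensor (V W : vectType K) : Type := 'M[K]_(dim V, dim W).
HB.instance Definition _ (V W : vectType K) := Vector.on (tensor V W).

Definition tbasis (V : vectType K) (i : 'I_(dim V)) : V := r2v (delta_mx 0 i).

Definition tens (V W : vectType K) (v : V) (w : W) : tensor V W :=
  (v2r v)^T *m v2r w.

(* The linear map with v ⊗ w |-> f v w, for bilinear f *)
Definition tlift (V W : vectType K) (U : lmodType K) (f : V -> W -> U)
    (T : tensor V W) : U :=
  \sum_i \sum_j T i j *: f (tbasis i) (tbasis j).

Definition tmap (V W V' W' : vectType K) (f : V -> V') (g : W -> W') :
    tensor V W -> tensor V' W' :=
  tlift (fun v w => tens (f v) (g w)).

Lemma tbasis_expand (V : vectType K) (v : V) :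
  v = \sum_i (v2r v) 0 i *: tbasis i.
Proof.
apply: (can_inj v2rK).
rewrite [in LHS](row_sum_delta (v2r v)) linear_sum; apply: eq_bigr => i _.
by rewrite linearZ /= /tbasis r2vK.
Qed.

Lemma tensE (V W : vectType K) (v : V) (w : W) i j :
  tens v w i j = v2r v 0 i * v2r w 0 j.
Proof. by rewrite /tens mxE big_ord1 mxE. Qed.

Lemma tlift_is_linear (V W : vectType K) (U : lmodType K) (f : V -> W -> U) :
  linear (tlift f).
Proof.
move=> a S T; rewrite /tlift scaler_sumr -big_split; apply: eq_bigr => i _ /=.
rewrite scaler_sumr -big_split; apply: eq_bigr => j _ /=.
by rewrite !mxE scalerDl scalerA.
Qed.
HB.instance Definition _ (V W : vectType K) (U : lmodType K) (f : V -> W -> U) :=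
  GRing.isLinear.Build K (tensor V W) U _ (tlift f) (tlift_is_linear f).

Definition bilin (V W U : lmodType K) (f : V -> W -> U) : Prop :=
  (forall w, linear (f^~ w)) /\ (forall v, linear (f v)).

Lemma linear_for_sum (V U : lmodType K) (f : V -> U) (I : Type) (r : seq I)
    (c : I -> K) (v : I -> V) :
  linear f -> f (\sum_(i <- r) c i *: v i) = \sum_(i <- r) c i *: f (v i).
Proof.
move=> lf.
have f0 : f 0 = 0.
  by have := lf (-1) 0 0; rewrite scaler0 addr0 scaleN1r addNr.
elim: r => [|i r IH]; first by rewrite !big_nil.
by rewrite !big_cons lf IH.
Qed.

Lemma tlift_tens (V W : vectType K) (U : lmodType K) (f : V -> W -> U) v w :
  bilin f -> tlift f (tens v w) = f v w.
Proof.
move=> [fl fr]; rewrite [in RHS](tbasis_expand v).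
rewrite (linear_for_sum _ _ _ (fl w)); apply: eq_bigr => i _.
rewrite [in RHS](tbasis_expand w) (linear_for_sum _ _ _ (fr _)) scaler_sumr.
by apply: eq_bigr => j _; rewrite tensE scalerA.
Qed.

Lemma tens_bilin (V W : vectType K) : bilin (@tens V W).
Proof.
split=> [w|v] a x y; apply/matrixP=> i j; rewrite !(tensE, mxE) linearP !mxE.
  by rewrite mulrDl mulrA.
by rewrite mulrDr mulrCA.
Qed.

Lemma tens_expand (V W : vectType K) (T : tensor V W) :
  T = \sum_i \sum_j T i j *: tens (tbasis i) (tbasis j).
Proof.
rewrite [LHS]matrix_sum_delta; apply: eq_bigr => i _; apply: eq_bigr => j _.
congr (_ *: _); apply/matrixP=> k l.
by rewrite tensE /tbasis !r2vK !mxE !eqxx /= -natrM mulnb.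
Qed.

Lemma tens_ext (V W : vectType K) (U : lmodType K) (f g : tensor V W -> U) :
  linear f -> linear g -> (forall v w, f (tens v w) = g (tens v w)) -> f =1 g.
Proof.
move=> lf lg fg T; rewrite [T]tens_expand pair_big /=.
rewrite !linear_for_sum //; apply: eq_bigr => p _; by rewrite fg.
Qed.

Lemma tmap_is_linear (V W V' W' : vectType K) (f : V -> V') (g : W -> W') :
  linear (tmap f g).
Proof. exact: tlift_is_linear. Qed.
HB.instance Definition _ (V W V' W' : vectType K) (f : V -> V') (g : W -> W') :=
  GRing.isLinear.Build K (tensor V W) (tensor V' W') _ (tmap f g)
    (tmap_is_linear f g).

Lemma tmap_tens (V W V' W' : vectType K) (f : V -> V') (g : W -> W') v w :
  linear f -> linear g -> tmap f g (tens v w) = tens (f v) (g w).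
Proof.
move=> lf lg; apply: (tlift_tens (f := fun v w => tens (f v) (g w))).
split=> [y|x] a z t; first by rewrite lf (tens_bilin V' W').1.
by rewrite lg (tens_bilin V' W').2.
Qed.

End Tensor.

Lemma normc_le_ReIm (R : realType) (a : R[i]) :
  `|a| <= ((`|complex.Re a| + `|complex.Im a|)%:C)%C.
Proof.
rewrite {1}[a]complexE (le_trans (ler_normD _ _)) // normrM !normc_def /=.
by rewrite !expr0n !expr1n /= !addr0 !add0r !sqrtr_sqr sqrtr1 mul1r -rmorphD.
Qed.

Section FiniteDimBound.
Variables (R : realType) (r : nat) (B : normedModType R[i]).
Variable g : 'I_r -> 'I_r -> B.

Let quad (x : 'I_r -> R[i]) : B := \sum_i \sum_j ((x i)^* * x j) *: g i j.
Let nm (b : B) : R := complex.Re `|b|.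
Let cplx (v : 'rV[R]_(r + r)) : 'I_r -> R[i] :=
  fun i => (v 0 (lshift r i) +i* v 0 (rshift r i))%C.

Let nmE b : `|b| = ((nm b)%:C)%C.
Proof. by rewrite /nm RRe_real // ger0_real. Qed.

Let nm_ge0 b : 0 <= nm b.
Proof. by rewrite -ler0c -nmE. Qed.

Let nmD b c : nm (b + c) <= nm b + nm c.
Proof. by rewrite -lecR rmorphD /= -!nmE ler_normD. Qed.

Let nm_sum (I : finType) (F : I -> B) : nm (\sum_i F i) <= \sum_i nm (F i).
Proof.
elim/big_rec2: _ => [|i y b _ h]; first by rewrite /nm normr0.
by rewrite (le_trans (nmD _ _)) // lerD2l.
Qed.

Let nm_dist b c : `|nm b - nm c| <= nm (b - c).
Proof.
have h1 := nmD (b - c) c; have h2 := nmD (c - b) b.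
rewrite !subrK in h1 h2; have h3 : nm (c - b) = nm (b - c) by rewrite /nm distrC.
by rewrite h3 in h2; rewrite ler_norml; apply/andP; split; lra.
Qed.

Let nmZ (a : R[i]) b : nm (a *: b) <= (`|complex.Re a| + `|complex.Im a|) * nm b.
Proof.
by rewrite -lecR rmorphM /= -!nmE normrZ ler_wpM2r // normc_le_ReIm.
Qed.

Let p (i j : 'I_r) (v : 'rV[R]_(r + r)) : R[i] := (cplx v i)^* * cplx v j.

Let ReIm_cont i j : continuous (fun v => complex.Re (p i j v)) /\
                    continuous (fun v => complex.Im (p i j v)).
Proof.
have cc k : continuous (fun v : 'rV[R]_(r + r) => v 0 k) by exact: coord_continuous.
have cj (a b : R) : ((a +i* b)%C : R[i])^* = (a -i* b)%C by [].
split.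
  rewrite (_ : (fun _ => _) = fun v : 'rV[R]_(r + r) =>
      v 0 (lshift r i) * v 0 (lshift r j) + v 0 (rshift r i) * v 0 (rshift r j)).
    by move=> v; apply: (cvgD (cvgM (cc _ v) (cc _ v)) (cvgM (cc _ v) (cc _ v))).
  by apply/funext => v; rewrite /p /cplx cj /=; ring.
rewrite (_ : (fun _ => _) = fun v : 'rV[R]_(r + r) =>
    v 0 (lshift r i) * v 0 (rshift r j) - v 0 (rshift r i) * v 0 (lshift r j)).
  by move=> v; apply: (cvgB (cvgM (cc _ v) (cc _ v)) (cvgM (cc _ v) (cc _ v))).
by apply/funext => v; rewrite /p /cplx cj /=; ring.
Qed.

Let F (v : 'rV[R]_(r + r)) : R := nm (quad (cplx v)).

Let F_cont : continuous F.
Proof.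
move=> w.
pose G v : R := \sum_(ij : 'I_r * 'I_r)
  (`|complex.Re (p ij.1 ij.2 v) - complex.Re (p ij.1 ij.2 w)| +
   `|complex.Im (p ij.1 ij.2 v) - complex.Im (p ij.1 ij.2 w)|) * nm (g ij.1 ij.2).
have FG v : `|F w - F v| <= G v.
  rewrite distrC (le_trans (nm_dist _ _)) // /quad !pair_big -sumrB /=.
  rewrite (le_trans (nm_sum _)) //; apply: ler_sum => ij _ /=.
  rewrite -scalerBl (le_trans (nmZ _ _)) //.
have fw : Filter (nbhs w) by exact: nbhs_filter.
have G0 : G v @[v --> w] --> (0 : R).
  have -> : (0 : R) =
      \sum_(ij : 'I_r * 'I_r) (`|0 : R| + `|0 : R|) * nm (g ij.1 ij.2).
    by rewrite big1 // => ij _; rewrite normr0 addr0 mul0r.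
  apply: cvg_big; first exact: add_continuous.
  move=> ij _; apply: cvgM; last exact: cvg_cst.
  have [cr ci] := ReIm_cont ij.1 ij.2.
  apply: cvgD; apply: cvg_norm.
    rewrite -[X in _ --> X](subrr (complex.Re (p ij.1 ij.2 w))).
    by apply: cvgB; [exact: cr|exact: cvg_cst].
  rewrite -[X in _ --> X](subrr (complex.Im (p ij.1 ij.2 w))).
  by apply: cvgB; [exact: ci|exact: cvg_cst].
apply/cvgrPdist_lt => e e0; move/cvgr0Pnorm_lt: G0 => /(_ e e0).
apply: filterS => v; apply: le_lt_trans; rewrite (le_trans (FG v)) //.
exact: ler_norm.
Qed.

Let F_scale (a : R) v : F (a *: v) = a ^+ 2 * F v.
Proof.
have q : quad (cplx (a *: v)) = ((a ^+ 2)%:C)%C *: quad (cplx v).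
  rewrite /quad scaler_sumr; apply: eq_bigr => i _.
  rewrite scaler_sumr; apply: eq_bigr => j _; rewrite scalerA; congr (_ *: _).
  have cplxZ k : cplx (a *: v) k = (a%:C)%C * cplx v k.
    by rewrite /cplx !mxE; apply/eqP; rewrite eq_complex /= !mul0r subr0 addr0 !eqxx.
  rewrite !cplxZ rmorphM rmorphXn /= [(a%:C)%C^*]conj_Creal ?complex_real //.
    by ring.
rewrite /F q; apply: complexI; rewrite [RHS]rmorphM -!nmE normrZ; congr (_ * _).
by rewrite normc_def /= expr0n /= addr0 sqrtr_sqr normrX real_normK ?num_real.
by rewrite nmE.
Qed.

Lemma quad_lower :
  (forall x, quad x = 0 -> forall i, x i = 0) ->
  exists2 m : R[i], 0 < m & forall x k, m * `|x k| ^+ 2 <= `|quad x|.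
Proof.
move=> def.
pose S := [set v : 'rV[R]_(r + r) | `|v| = 1].
have [m0 m0_gt0 lower] : exists2 m0, 0 < m0 & forall v, m0 * `|v| ^+ 2 <= F v.
  have norml v : v != 0 -> S (`|v|^-1 *: v).
    by move=> v0; rewrite /S /= normrZ normfV normr_id mulVf // normr_eq0.
  have [S0|] := pselect (S !=set0); last first.
    move=> S0; exists 1 => // v; have [->|/norml Sv] := eqVneq v 0.
      by rewrite normr0 expr0n mulr0 nm_ge0.
    by case: S0; exists (`|v|^-1 *: v).
  have cS : compact S.
    apply: bounded_closed_compact.
      by exists 1; split=> // M M1 v; rewrite /S /= => ->; exact: ltW.
    rewrite (_ : S = Num.norm @^-1` [set 1]) //.
    by apply: closed_comp => [? _|]; [exact: norm_continuous|exact: closed_eq].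
  have [c /set_mem cS1 cmin] := EVT_min_rV S0 cS (continuous_subspaceT F_cont).
  have c0 : c != 0 by rewrite -normr_eq0 cS1 oner_eq0.
  exists (F c) => [|v].
    rewrite lt_neqAle nm_ge0 andbT eq_sym; apply: contra_neq c0 => Fc.
    have q0 : quad (cplx c) = 0.
      by apply/eqP; rewrite -normr_eq0 nmE -/(F c) Fc.
    apply/rowP => k; rewrite mxE; case: (splitP k) => i ki.
      have -> : k = lshift r i by exact: val_inj.
      by have := def _ q0 i; rewrite /cplx => -[].
    have -> : k = rshift r i by exact: val_inj.
    by have := def _ q0 i; rewrite /cplx => -[].
  have [->|v0] := eqVneq v 0; first by rewrite normr0 expr0n mulr0 nm_ge0.
  have nv : 0 < `|v| by rewrite normr_gt0.
  have := cmin _ (mem_set (norml _ v0)).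
  by rewrite F_scale exprVn ler_pdivlMl ?exprn_gt0 // mulrC.
exists (((m0 / 4)%:C)%C) => [|x k]; first by rewrite (ltcR 0) divr_gt0.
pose v : 'rV[R]_(r + r) :=
  row_mx (\row_i complex.Re (x i)) (\row_i complex.Im (x i)).
have xv : x = cplx v.
  apply/funext => i; rewrite /cplx /v row_mxEl row_mxEr !mxE; by case: (x i).
rewrite [in leRHS]xv nmE -/(F v).
have vk l : `|v 0 l| <= `|v|.
  rewrite [leRHS]/Num.norm /= mx_normrE; apply/bigmax_geP; right => /=.
  by exists (0, l).
have : `|x k| <= ((2 * `|v|)%:C)%C.
  rewrite (le_trans (normc_le_ReIm _)) // lecR mulr_natl mulr2n lerD //.
    by rewrite (_ : complex.Re _ = v 0 (lshift r k)) ?vk // xv.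
  by rewrite (_ : complex.Im _ = v 0 (rshift r k)) ?vk // xv.
move=> xk; have xk2 : `|x k| ^+ 2 <= ((4 * `|v| ^+ 2)%:C)%C.
  rewrite (_ : 4 * _ = (2 * `|v|) ^+ 2); last by ring.
  rewrite rmorphXn /= lerXn2r // nnegrE ?normr_ge0 //.
  by rewrite ler0c mulr_ge0.
apply: le_trans (_ : ((m0 * `|v| ^+ 2)%:C)%C <= _); last by rewrite lecR.
rewrite (_ : m0 * `|v| ^+ 2 = (m0 / 4) * (4 * `|v| ^+ 2)); last by field.
by rewrite [in leRHS]rmorphM ler_wpM2l // ler0c divr_ge0 // ltW.
Qed.

End FiniteDimBound.

Section FiniteDimComplete.
Variable R : realType.

Lemma real_seq_complete (u : nat -> R) :
  (forall e : R, 0 < e -> exists N, forall m n,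
     (N <= m)%N -> (N <= n)%N -> `|u m - u n| < e) ->
  exists l, forall e : R, 0 < e -> exists N, forall n,
     (N <= n)%N -> `|u n - l| < e.
Proof.
move=> cu.
have cvu : cvg (u @ \oo).
  apply/cauchy_cvgP/cauchy_exP => e e0; have [N uN] := cu e e0.
  exists (u N); exists N => // n /= Nn; rewrite -ball_normE /=.
  exact: uN.
exists (lim (u @ \oo)) => e e0.
move/cvgrPdist_lt: cvu => /(_ e e0)[N _ uN]; exists N => n Nn.
by rewrite distrC; apply: uN.
Qed.

Lemma complex_seq_complete (u : nat -> R[i]) :
  (forall e : R[i], 0 < e -> exists N, forall m n,
     (N <= m)%N -> (N <= n)%N -> `|u m - u n| < e) ->
  exists l, forall e : R[i], 0 < e -> exists N, forall n,
     (N <= n)%N -> `|u n - l| < e.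
Proof.
move=> cu.
have ReB (a b : R[i]) : complex.Re (a - b) = complex.Re a - complex.Re b.
  by case: a; case: b.
have ImB (a b : R[i]) : complex.Im (a - b) = complex.Im a - complex.Im b.
  by case: a; case: b.
have le_Re (a : R[i]) : ((`|complex.Re a|)%:C)%C <= `|a| by exact: normc_ge_Re.
have le_Im (a : R[i]) : ((`|complex.Im a|)%:C)%C <= `|a|.
  rewrite normc_def lecR -[leLHS]sqrtr_sqr ler_sqrt ?addr_ge0 ?sqr_ge0 //.
  by rewrite lerDr sqr_ge0.
have [a ha] : exists l, forall e : R, 0 < e -> exists N, forall n,
     (N <= n)%N -> `|complex.Re (u n) - l| < e.
  apply: real_seq_complete => e e0.
  have [|N uN] := cu ((e%:C)%C); first by rewrite (ltcR 0).
  exists N => m n Nm Nn; rewrite -ltcR -ReB.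
  exact: le_lt_trans (le_Re _) (uN _ _ Nm Nn).
have [b hb] : exists l, forall e : R, 0 < e -> exists N, forall n,
     (N <= n)%N -> `|complex.Im (u n) - l| < e.
  apply: real_seq_complete => e e0.
  have [|N uN] := cu ((e%:C)%C); first by rewrite (ltcR 0).
  exists N => m n Nm Nn; rewrite -ltcR -ImB.
  exact: le_lt_trans (le_Im _) (uN _ _ Nm Nn).
exists (a +i* b)%C => e e0.
have eE : e = ((complex.Re e)%:C)%C by rewrite RRe_real // ger0_real // ltW.
have e2 : 0 < complex.Re e / 2 by rewrite divr_gt0 // -ltcR -eE.
have [N1 h1] := ha _ e2; have [N2 h2] := hb _ e2.
exists (maxn N1 N2) => n; rewrite geq_max => /andP[n1 n2].
rewrite (le_lt_trans (normc_le_ReIm _)) // eE ltcR ReB ImB /=.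
by rewrite [ltRHS]splitr ltrD ?h1 ?h2.
Qed.

Variables (X : vectType R[i]) (B : normedModType R[i]) (f : X -> X -> B).
Hypothesis flinr : forall (a : R[i]) xi eta zeta,
  f xi (a *: eta + zeta) = a *: f xi eta + f xi zeta.
Hypothesis flinl : forall (a : R[i]) xi eta zeta,
  f (a *: xi + eta) zeta = a^* *: f xi zeta + f eta zeta.
Hypothesis fdef : forall xi, f xi xi = 0 -> xi = 0.

Lemma form_expand x : f x x = \sum_i \sum_j
  ((v2r x 0 i)^* * v2r x 0 j) *: f (tbasis i) (tbasis j).
Proof.
have l0 z : f 0 z = 0.
  by have := flinl (-1) 0 0 z; rewrite scaler0 addr0 rmorphN1 scaleN1r addNr.
have expl z : f x z = \sum_i (v2r x 0 i)^* *: f (tbasis i) z.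
  rewrite [x in LHS]tbasis_expand; elim/big_rec2: _ => // i y1 y2 _ <-.
  exact: flinl.
rewrite expl; apply: eq_bigr => i _.
rewrite [x in f _ x]tbasis_expand linear_for_sum; last by move=> *; exact: flinr.
by rewrite scaler_sumr; apply: eq_bigr => j _; rewrite scalerA.
Qed.

Lemma finite_dim_complete (u : nat -> X) :
  (forall e : R[i], 0 < e -> exists N, forall m n,
     (N <= m)%N -> (N <= n)%N -> sqrtC `|f (u m - u n) (u m - u n)| < e) ->
  exists l, forall e : R[i], 0 < e -> exists N, forall n,
     (N <= n)%N -> sqrtC `|f (u n - l) (u n - l)| < e.
Proof.
move=> cu.
have sqrt_lt (a e : R[i]) : 0 <= a -> 0 < e -> (sqrtC a < e) = (a < e ^+ 2).
  by move=> a0 e0; rewrite -[e in LHS]sqrCK ?ltW // ltr_sqrtC ?nnegrE ?exprn_ge0 // ltW.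
have [|m m0 low] := @quad_lower R _ B (fun i j => f (tbasis i) (tbasis j)).
  move=> x x0 i; pose y : X := r2v (\row_i x i).
  have y0 : y = 0.
    apply: fdef; rewrite form_expand -[RHS]x0.
    by apply: eq_bigr => k _; apply: eq_bigr => l _; rewrite r2vK !mxE.
  by have := congr1 (fun z => v2r z 0 i) y0; rewrite r2vK linear0 !mxE.
have cc k : exists l, forall e : R[i], 0 < e -> exists N, forall n,
     (N <= n)%N -> `|v2r (u n) 0 k - l| < e.
  apply: complex_seq_complete => e e0.
  have e1 : 0 < e * sqrtC m by rewrite mulr_gt0 // sqrtC_gt0.
  have [N uN] := cu _ e1; exists N => n1 n2 N1 N2.
  have := uN _ _ N1 N2; rewrite sqrt_lt // form_expand => h.
  have := le_lt_trans (low _ k) h.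
  rewrite linearB /= !mxE exprMn sqrtCK mulrC ltr_pM2r //.
  by rewrite ltr_pXn2r ?nnegrE // ltW.
have [l lP] := choice cc.
exists (r2v (\row_k l k)) => e e0.
pose M : R[i] := \sum_i \sum_j `|f (tbasis i : X) (tbasis j)|.
have M0 : 0 <= M by apply: sumr_ge0 => i _; apply: sumr_ge0.
have M1 : 0 < M + 1 by rewrite ltr_wpDl.
pose d := e / (M + 1); have d0 : 0 < d by rewrite divr_gt0.
have [N NP] := choice (fun k => lP k d d0).
exists (\max_k N k)%N => n Nn; rewrite sqrt_lt //.
have dM : d ^+ 2 * M < e ^+ 2.
  rewrite exprMn -mulrA gtr_pMr ?exprn_gt0 // exprVn mulrC ltr_pdivrMr ?exprn_gt0 //.
  rewrite mul1r (lt_le_trans (_ : M < M + 1)) ?ltrDl // expr2 ler_peMl ?lerDr //.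
  exact: ltW.
apply: le_lt_trans dM; rewrite form_expand /M mulr_sumr.
rewrite (le_trans (ler_norm_sum _ _ _)) //; apply: ler_sum => i _.
rewrite mulr_sumr (le_trans (ler_norm_sum _ _ _)) //; apply: ler_sum => j _.
have small k : `|v2r (u n - r2v (\row_k l k)) 0 k| <= d.
  rewrite linearB /= r2vK !mxE ltW // NP //.
  exact: leq_trans (leq_bigmax k) Nn.
rewrite normrZ normrM norm_conjC ler_wpM2r // expr2.
by rewrite ler_pM // small.
Qed.

End FiniteDimComplete.

Section GramFactor.
Variables (C : numClosedFieldType) (n : nat) (G : 'M[C]_n).
Hypothesis Gherm : forall i j, (G i j)^* = G j i.
Hypothesis Gpos : forall x : 'I_n -> C,
  0 <= \sum_i \sum_j (x i)^* * x j * G i j.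
Hypothesis Gdef : forall x : 'I_n -> C,
  \sum_i \sum_j (x i)^* * x j * G i j = 0 -> forall i, x i = 0.

Lemma gram_factor : exists2 P : 'M[C]_n, P \in unitmx &
  forall i j, G i j = \sum_r (P r i)^* * P r j.
Proof.
have Gt : map_mx Num.conj G^T = G by apply/matrixP => i j; rewrite !mxE Gherm.
have /orthomx_spectralP GE : G \is normalmx by apply/normalmxP; rewrite Gt.
set U := spectralmx G in GE; set d := spectral_diag G in GE.
have Uu : U \is unitarymx by exact: spectral_unitarymx.
have Ui : U \in unitmx by exact: spectral_unit.
rewrite invmx_unitary // in GE.
have dE r : d 0 r = \sum_i \sum_j ((U r i)^*)^* * (U r j)^* * G i j.
  have : U *m G *m map_mx Num.conj U^T = diag_mx d.
    rewrite {1}GE !mulmxA (unitarymxP Uu) mul1mx -mulmxA (unitarymxP Uu).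
    by rewrite mulmx1.
  move/matrixP/(_ r r); rewrite [in RHS]mxE eqxx mulr1n => <-.
  rewrite mxE exchange_big; apply: eq_bigr => j _ /=; rewrite mxE mulr_suml.
  by apply: eq_bigr => i _; rewrite !mxE conjCK mulrAC.
have d0 r : 0 < d 0 r.
  have d_ge0 : 0 <= d 0 r by rewrite dE; exact: Gpos.
  rewrite lt_neqAle d_ge0 andbT eq_sym; apply/negP => /eqP.
  rewrite dE => /Gdef Ur0; have : row r U = 0.
    by apply/rowP => i; rewrite !mxE -[LHS]conjCK Ur0 conjC0.
  move=> rU; have := unitarymxP Uu => /matrixP/(_ r r).
  rewrite !mxE eqxx big1 => [/eqP|i _]; first by rewrite eq_sym oner_eq0.
  by have := congr1 (fun z : 'rV_n => z 0 i) rU; rewrite !mxE => ->; rewrite mul0r.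
exists (diag_mx (map_mx sqrtC d) *m U).
  rewrite unitmx_mul Ui andbT unitmxE det_diag unitfE; apply/prodf_neq0 => r _.
  by rewrite mxE sqrtC_eq0 gt_eqF.
move=> i j; rewrite {1}GE mxE; apply: eq_bigr => r _.
rewrite !mul_diag_mx mul_mx_diag !mxE rmorphM /= [(sqrtC _)^*]conj_Creal.
  by rewrite [RHS]mulrACA -expr2 sqrtCK mulrCA mulrA.
by rewrite ger0_real // sqrtC_ge0 ltW.
Qed.

End GramFactor.

Section Sesquilinear.
Variables (R : realType) (V W : vectType R[i]) (U : lmodType R[i]).

(* The sesquilinear map (antilinear on the left) sending (a ⊗ b, c ⊗ d) to    *)
(* f a b c d.                                                                 *)
Definition tsesq (f : V -> W -> V -> W -> U) (S T : tensor V W) : U :=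
  \sum_i \sum_j (S i j)^* *: tlift (f (tbasis i) (tbasis j)) T.

Lemma tsesq_linear f S : linear (tsesq f S).
Proof.
move=> a T T'; rewrite /tsesq scaler_sumr -big_split; apply: eq_bigr => i _ /=.
rewrite scaler_sumr -big_split; apply: eq_bigr => j _ /=.
by rewrite linearP scalerDr !scalerA mulrC.
Qed.

Lemma tsesq_antilinear f T a S S' :
  tsesq f (a *: S + S') T = a^* *: tsesq f S T + tsesq f S' T.
Proof.
rewrite /tsesq scaler_sumr -big_split; apply: eq_bigr => i _ /=.
rewrite scaler_sumr -big_split; apply: eq_bigr => j _ /=.
by rewrite !mxE rmorphD rmorphM scalerDl scalerA.
Qed.

Lemma tsesq_tens f a b c d :
  (forall a b, bilin (f a b)) ->
  (forall b x y z t, f (x *: y + z) b t = fun u => x^* *: f y b t u + f z b t u) ->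
  (forall a x y z t, f a (x *: y + z) t = fun u => x^* *: f a y t u + f a z t u) ->
  tsesq f (tens a b) (tens c d) = f a b c d.
Proof.
move=> fr fa fb.
have expand (Y : vectType R[i]) (g : Y -> U) (v : Y) :
    (forall x y z, g (x *: y + z) = x^* *: g y + g z) ->
    g v = \sum_i ((v2r v) 0 i)^* *: g (tbasis i).
  move=> gP; rewrite [v in LHS]tbasis_expand.
  have g0 : g 0 = 0 by have := gP (-1) 0 0;
    rewrite scaler0 addr0 rmorphN1 scaleN1r addNr.
  elim/big_rec2: _ => // i y1 y2 _ <-; exact: gP.
rewrite (expand _ (fun a => f a b c d)); last by move=> x y z; rewrite fa.
rewrite /tsesq; apply: eq_bigr => i _.
rewrite (expand _ (fun b => f _ b c d)); last by move=> x y z; rewrite fb.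
rewrite scaler_sumr; apply: eq_bigr => j _.
by rewrite tlift_tens // tensE rmorphM scalerA.
Qed.

End Sesquilinear.

Section QuantumGraphs.
Variable R : realType.

Section FiniteQuantumSpace.
Variables (B : fdCstarType R) (psi : {scalar B}).

(* The norm of a positive functional on a unital C*-algebra is its value at 1. *)
Definition faithful_state : Prop :=
  [/\ forall x, 0 <= psi (x^† ∙ x), psi cone = 1
    & forall x, psi (x^† ∙ x) = 0 -> x = 0].

Definition psi_ip (x y : B) : R[i] := psi (x^† ∙ y).

Definition psi2_ip : tensor B B -> tensor B B -> R[i] :=
  tsesq (U := R[i]^o) (fun a b c d => psi_ip a c * psi_ip b d).

Definition mult : tensor B B -> B := tlift (@cmul R B).

Definition mult_adjoint (mstar : B -> tensor B B) : Prop :=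
  forall (T : tensor B B) (y : B), psi_ip (mult T) y = psi2_ip T (mstar y).

Definition delta_form (delta : R) : Prop :=
  exists2 mstar, mult_adjoint mstar &
    forall x, mult (mstar x) = ((delta ^+ 2)%:C)%C *: x.

End FiniteQuantumSpace.

Record quantumSpace := QuantumSpace {
  qs_alg :> fdCstarType R;
  qs_psi : {scalar qs_alg};
  qs_delta : R;
  qs_delta_gt0 : 0 < qs_delta;
  qs_state : faithful_state qs_psi;
  qs_delta_form : delta_form qs_psi qs_delta }.

(* m^*: the adjoint is unique, the form of the faithful state psi being       *)
(* nondegenerate.                                                             *)
Definition comult (Q : quantumSpace) : Q -> tensor Q Q :=
  projT1 (cid2 (qs_delta_form Q)).

Record quantumGraph := QuantumGraph {
  qg_space :> quantumSpace;
  qg_adj : {linear qg_space -> qg_space};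
  qg_adjP : forall x : qg_space,
    mult (tmap qg_adj qg_adj (comult x))
    = ((qs_delta qg_space ^+ 2)%:C)%C *: qg_adj x }.

Lemma cmul_bilin (B : cstarType R) : bilin (@cmul R B).
Proof.
by split=> [z|z] a x y; [exact: cmul_linl | exact: cmul_linr].
Qed.

Lemma cmul0l (B : cstarType R) (x : B) : 0 ∙ x = 0.
Proof. by have := cmul_linl (-1) 0 0 x; rewrite scaler0 addr0 scaleN1r addNr. Qed.
Lemma cmul0r (B : cstarType R) (x : B) : x ∙ 0 = 0.
Proof. by have := cmul_linr (-1) 0 0 x; rewrite scaler0 addr0 scaleN1r addNr. Qed.
Lemma cmulDl (B : cstarType R) (x y z : B) : (x + y) ∙ z = x ∙ z + y ∙ z.
Proof. by have := cmul_linl 1 x y z; rewrite !scale1r. Qed.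
Lemma cmulDr (B : cstarType R) (x y z : B) : z ∙ (x + y) = z ∙ x + z ∙ y.
Proof. by have := cmul_linr 1 x y z; rewrite !scale1r. Qed.
Lemma cmulZl (B : cstarType R) a (x z : B) : (a *: x) ∙ z = a *: (x ∙ z).
Proof. by have := cmul_linl a x 0 z; rewrite !addr0 cmul0l addr0. Qed.
Lemma cmulZr (B : cstarType R) a (x z : B) : z ∙ (a *: x) = a *: (z ∙ x).
Proof. by have := cmul_linr a x 0 z; rewrite !addr0 cmul0r addr0. Qed.
Lemma cstar0 (B : cstarType R) : (0 : B)^† = 0.
Proof.
by have := cstar_antilin (-1) (0 : B) 0;
   rewrite scaler0 addr0 rmorphN1 scaleN1r addNr.
Qed.
Lemma cstarD (B : cstarType R) (x y : B) : (x + y)^† = x^† + y^†.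
Proof. by have := cstar_antilin 1 x y; rewrite rmorph1 !scale1r. Qed.
Lemma cstarZ (B : cstarType R) a (x : B) : (a *: x)^† = a^* *: x^†.
Proof. by have := cstar_antilin a x 0; rewrite !addr0 cstar0 addr0. Qed.
Lemma cstar_sum (B : cstarType R) I (r : seq I) P (F : I -> B) :
  (\sum_(i <- r | P i) F i)^† = \sum_(i <- r | P i) (F i)^†.
Proof. exact: (big_morph _ (@cstarD B) (cstar0 B)). Qed.
Lemma cmul_suml (B : cstarType R) I (r : seq I) P (F : I -> B) z :
  (\sum_(i <- r | P i) F i) ∙ z = \sum_(i <- r | P i) F i ∙ z.
Proof. by apply: (big_morph (cmul^~ z)) => [x y|]; rewrite ?cmulDl ?cmul0l. Qed.
Lemma cmul_sumr (B : cstarType R) I (r : seq I) P (F : I -> B) z :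
  z ∙ (\sum_(i <- r | P i) F i) = \sum_(i <- r | P i) z ∙ F i.
Proof. by apply: (big_morph (cmul z)) => [x y|]; rewrite ?cmulDr ?cmul0r. Qed.

Lemma cone_star (B : unitalCstarType R) : (cone : B)^† = cone.
Proof.
by rewrite -[LHS]cmul1 -[in RHS](cstarK cone) -[in RHS](cmul1 cone^†) cstarM cstarK.
Qed.

Section PsiForm.
Variables (B : fdCstarType R) (psi : {scalar B}).
Hypothesis state : faithful_state psi.

Lemma psi_star x : psi (x^†) = (psi x)^*.
Proof.
case: state => pos _ _.
have polar a : psi ((a *: x + cone)^† ∙ (a *: x + cone)) =
    (a^* * a) * psi (x^† ∙ x) + a^* * psi (x^†) + a * psi x + psi cone.
  rewrite cstarD cstarZ cone_star cmulDl !cmulDr !cmulZl !cmulZr !cmul1 !c1mul.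
  rewrite !linearD !linearZ /=. ring.
have real1 a : (a^* * psi (x^†) + a * psi x)^* = a^* * psi (x^†) + a * psi x.
  have -> : a^* * psi (x^†) + a * psi x =
      psi ((a *: x + cone)^† ∙ (a *: x + cone)) - (a^* * a) * psi (x^† ∙ x)
      - psi cone by rewrite polar; ring.
  have cone_pos : 0 <= psi cone by rewrite -[cone]c1mul -{1}cone_star.
  apply: conj_Creal; rewrite !rpredB ?ger0_real ?pos //.
  by rewrite mulr_ge0 ?pos // mulrC mul_conjC_ge0.
have H1 := real1 1; rewrite rmorph1 !mul1r rmorphD /= in H1.
have Hi := real1 'i; rewrite conjCi rmorphD !rmorphM rmorphN /= conjCi opprK in Hi.
have Hi' : (psi x^†)^* - (psi x)^* = psi x - psi x^†.
  apply: (mulfI (neq0Ci _)); transitivity ('i * (psi x^†)^* + - 'i * (psi x)^*).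
    by ring.
  by rewrite Hi; ring.
have two0 : 2%:R != 0 :> R[i] by rewrite pnatr_eq0.
apply: (mulfI two0).
have -> : 2%:R * (psi x)^* = ((psi x^†)^* + (psi x)^*) - ((psi x^†)^* - (psi x)^*).
  by ring.
by rewrite H1 Hi'; ring.
Qed.

Definition edge_ip : tensor B B -> tensor B B -> B :=
  tsesq (fun a b c d => psi_ip psi a c *: (b^† ∙ d)).

Lemma psi_ip_linr (a : R[i]) x y z :
  psi_ip psi z (a *: x + y) = a * psi_ip psi z x + psi_ip psi z y.
Proof. by rewrite /psi_ip cmul_linr linearD linearZ. Qed.

Lemma psi_ip_linl (a : R[i]) x y z :
  psi_ip psi (a *: x + y) z = a^* * psi_ip psi x z + psi_ip psi y z.
Proof. by rewrite /psi_ip cstar_antilin cmul_linl linearD linearZ. Qed.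

Lemma psi_ip_star x y : (psi_ip psi x y)^* = psi_ip psi y x.
Proof. by rewrite /psi_ip -psi_star cstarM cstarK. Qed.

Lemma edge_ip_linr (a : R[i]) (S T T' : tensor B B) :
  edge_ip S (a *: T + T') = a *: edge_ip S T + edge_ip S T'.
Proof. exact: tsesq_linear. Qed.

Lemma edge_ip_linear S : linear (edge_ip S).
Proof. by move=> a T T'; rewrite edge_ip_linr. Qed.

Lemma edge_ip_linl (a : R[i]) (S S' T : tensor B B) :
  edge_ip (a *: S + S') T = a^* *: edge_ip S T + edge_ip S' T.
Proof. exact: tsesq_antilinear. Qed.

Lemma edge_ip_tens a b c d :
  edge_ip (tens a b) (tens c d) = psi_ip psi a c *: (b^† ∙ d).
Proof.
apply: tsesq_tens => [x y|t x y z u|t x y z u].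
- split=> [w|w] p v z.
    by rewrite psi_ip_linr scalerDl scalerA.
  by rewrite cmul_linr scalerDr !scalerA mulrC.
- by apply/funext => v; rewrite psi_ip_linl scalerDl scalerA.
- by apply/funext => v; rewrite cstar_antilin cmul_linl scalerDr !scalerA mulrC.
Qed.

Lemma edge_ip_star S T : (edge_ip S T)^† = edge_ip T S.
Proof.
have lin : linear (fun S => (edge_ip S T)^†).
  by move=> a S1 S2; rewrite edge_ip_linl cstar_antilin conjCK.
move: S; apply: (tens_ext lin (edge_ip_linear T)) => c d.
apply: (can_inj (@cstarK R B)); rewrite cstarK.
have lin2 : linear (fun T => (edge_ip T (tens c d))^†).
  by move=> a T1 T2; rewrite edge_ip_linl cstar_antilin conjCK.
move: T {lin}; apply: (tens_ext (edge_ip_linear (tens c d)) lin2) => a b.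
by rewrite !edge_ip_tens cstarZ cstarM cstarK psi_ip_star.
Qed.

Definition edge_lact (x : B) : tensor B B -> tensor B B := tmap (cmul x) id.
Definition edge_ract (T : tensor B B) (y : B) : tensor B B := tmap id (cmul^~ y) T.

Lemma edge_lact_tens x a b : edge_lact x (tens a b) = tens (x ∙ a) b.
Proof. by apply: tmap_tens => // p u v; rewrite cmul_linr. Qed.

Lemma edge_ract_tens y a b : edge_ract (tens a b) y = tens a (b ∙ y).
Proof. by apply: tmap_tens => // p u v; rewrite cmul_linl. Qed.

Lemma edge_lact_linr x : linear (edge_lact x).
Proof. exact: tmap_is_linear. Qed.

Lemma edge_ract_linl y : linear (edge_ract^~ y).
Proof. exact: tmap_is_linear. Qed.

Lemma linear_comb (V U : lmodType R[i]) (f g : V -> U) (a : R[i]) :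
  linear f -> linear g -> linear (fun x => a *: f x + g x).
Proof.
move=> lf lg b x y; rewrite lf lg !scalerDr !scalerA addrACA.
by rewrite [in RHS]mulrC.
Qed.

Lemma linear_comp (U V W : lmodType R[i]) (f : V -> W) (g : U -> V) :
  linear f -> linear g -> linear (f \o g).
Proof. by move=> lf lg a x y; rewrite /= lg lf. Qed.

Lemma edge_lact_linl (a : R[i]) x y T :
  edge_lact (a *: x + y) T = a *: edge_lact x T + edge_lact y T.
Proof.
move: T; apply: (tens_ext (edge_lact_linr _)
  (linear_comb _ (edge_lact_linr _) (edge_lact_linr _))) => c d.
by rewrite !edge_lact_tens cmul_linl (tens_bilin B B).1.
Qed.

Lemma edge_ract_linr (a : R[i]) T x y :
  edge_ract T (a *: x + y) = a *: edge_ract T x + edge_ract T y.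
Proof.
move: T; apply: (tens_ext (edge_ract_linl _)
  (linear_comb _ (edge_ract_linl _) (edge_ract_linl _))) => c d.
by rewrite !edge_ract_tens cmul_linr (tens_bilin B B).2.
Qed.

Lemma edge_lactM x y T : edge_lact (x ∙ y) T = edge_lact x (edge_lact y T).
Proof.
move: T; apply: (tens_ext (edge_lact_linr _)
  (linear_comp (edge_lact_linr x) (edge_lact_linr y))) => c d.
by rewrite /= !edge_lact_tens cmulA.
Qed.

Lemma edge_ractM T x y : edge_ract T (x ∙ y) = edge_ract (edge_ract T x) y.
Proof.
move: T; apply: (tens_ext (edge_ract_linl _)
  (linear_comp (edge_ract_linl y) (edge_ract_linl x))) => c d.
by rewrite /= !edge_ract_tens cmulA.
Qed.

Lemma edge_lract x T y :
  edge_lact x (edge_ract T y) = edge_ract (edge_lact x T) y.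
Proof.
move: T; apply: (tens_ext (linear_comp (edge_lact_linr x) (edge_ract_linl y))
  (linear_comp (edge_ract_linl y) (edge_lact_linr x))) => c d.
by rewrite /= !(edge_lact_tens, edge_ract_tens).
Qed.

Lemma edge_ip_ract S T b : edge_ip S (edge_ract T b) = edge_ip S T ∙ b.
Proof.
have lin T' : linear (fun S => (edge_ip S T')^†).
  by move=> a S1 S2; rewrite edge_ip_linl cstar_antilin conjCK.
move: T; apply: (tens_ext (linear_comp (edge_ip_linear S) (edge_ract_linl b)) _).
  by move=> a T1 T2; rewrite edge_ip_linr cmul_linl.
move=> c d; rewrite /= -[LHS]cstarK -[RHS]cstarK; congr (_^†).
move: S; apply: tens_ext => [||a a']; first exact: lin.
  by move=> p S1 S2; rewrite cstarM lin cmul_linr -!cstarM.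
by rewrite edge_ract_tens !edge_ip_tens cmulZl cmulA.
Qed.

Lemma edge_lact_adj x S T :
  edge_ip (edge_lact x S) T = edge_ip S (edge_lact (x^†) T).
Proof.
move: T; apply: (tens_ext (edge_ip_linear _)
  (linear_comp (edge_ip_linear S) (edge_lact_linr _))) => c d /=.
rewrite -[LHS]cstarK -[RHS]cstarK; congr (_^†).
move: S; apply: tens_ext => [||a b].
- by move=> p S1 S2; rewrite edge_lact_linr edge_ip_linl cstar_antilin conjCK.
- by move=> p S1 S2; rewrite edge_ip_linl cstar_antilin conjCK.
rewrite !edge_lact_tens !edge_ip_tens; congr ((_ *: _)^†).
by rewrite /psi_ip cstarM cmulA.
Qed.

Lemma psi_gram : exists2 P : 'M[R[i]]_(dim B), P \in unitmx &
  forall i j, psi_ip psi (tbasis i : B) (tbasis j)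
              = \sum_r (P r i)^* * P r j.
Proof.
pose G := \matrix_(i, j) psi_ip psi (tbasis i : B) (tbasis j).
pose comb (x : 'I_(dim B) -> R[i]) : B := r2v (\row_i x i).
have GE x : \sum_i \sum_j (x i)^* * x j * G i j = psi_ip psi (comb x) (comb x).
  have := @form_expand R B R[i]^o (psi_ip psi) _ _ (comb x).
  move=> -> => [|a y z t|a y z t]; last 2 first.
  - exact: psi_ip_linr.
  - exact: psi_ip_linl.
  apply: eq_bigr => i _; apply: eq_bigr => j _.
  by rewrite r2vK !mxE.
case: state => pos _ faith.
have [||x /[!GE]|P Pu PE] := @gram_factor _ _ G.
- by move=> i j; rewrite !mxE psi_ip_star.
- by move=> x; rewrite GE pos.
- by move=> /faith x0 i;
     have := congr1 (fun z => v2r z 0 i) x0; rewrite r2vK linear0 !mxE.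
by exists P => // i j; rewrite -PE mxE.
Qed.

Definition tens_row (T : tensor B B) (i : 'I_(dim B)) : B :=
  \sum_j T i j *: tbasis j.

Lemma tens_rowE T : T = \sum_i tens (tbasis i) (tens_row T i).
Proof.
rewrite [LHS]tens_expand; apply: eq_bigr => i _.
by rewrite /tens_row linear_for_sum //; exact: (tens_bilin B B).2.
Qed.

Lemma edge_ip_rows T : edge_ip T T =
  \sum_i \sum_k psi_ip psi (tbasis i) (tbasis k) *: ((tens_row T i)^† ∙ tens_row T k).
Proof.
have sumr S I (r : seq I) (F : I -> tensor B B) :
    edge_ip S (\sum_(i <- r) F i) = \sum_(i <- r) edge_ip S (F i).
  under eq_bigr do rewrite -[F _]scale1r.
  rewrite linear_for_sum; last exact: edge_ip_linear.
  by under eq_bigr do rewrite scale1r.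
rewrite [in LHS](tens_rowE T) sumr [RHS]exchange_big; apply: eq_bigr => k _ /=.
rewrite -[LHS]edge_ip_star sumr cstar_sum; apply: eq_bigr => i _.
by rewrite edge_ip_star edge_ip_tens.
Qed.

Lemma edge_ip_squares : exists2 P : 'M[R[i]]_(dim B), P \in unitmx &
  forall T, edge_ip T T =
    \sum_r (\sum_k P r k *: tens_row T k)^† ∙ (\sum_k P r k *: tens_row T k).
Proof.
have [P Pu PE] := psi_gram; exists P => // T; rewrite edge_ip_rows.
under eq_bigr do under eq_bigr do rewrite PE scaler_suml.
under eq_bigr do rewrite exchange_big.
rewrite exchange_big; apply: eq_bigr => r _ /=.
rewrite cstar_sum cmul_suml; apply: eq_bigr => i _.
rewrite cmul_sumr; apply: eq_bigr => k _.
by rewrite cstarZ cmulZl cmulZr scalerA.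
Qed.

Lemma edge_ip_pos T : cpositive (edge_ip T T).
Proof.
have [P _ PE] := edge_ip_squares.
exists [seq \sum_k P r k *: tens_row T k | r <- enum 'I_(dim B)].
by rewrite big_map big_enum PE.
Qed.

Lemma edge_ip_def T : edge_ip T T = 0 -> T = 0.
Proof.
have [P Pu PE] := edge_ip_squares; rewrite PE => T0.
case: state => pos _ faith.
have y0 r : \sum_k P r k *: tens_row T k = 0.
  apply: faith; have := congr1 psi T0; rewrite linear_sum linear0 => /eqP.
  rewrite psumr_eq0 => [/allP/(_ r)|s _]; last exact: pos.
  by rewrite mem_index_enum => /(_ isT)/eqP.
have c0 l : tens_row T l = 0.
  have PV k : \sum_r invmx P l r * P r k = (l == k)%:R.
    by have := mulVmx Pu => /matrixP/(_ l k); rewrite !mxE.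
  transitivity (\sum_r invmx P l r *: (\sum_k P r k *: tens_row T k)); last first.
    by apply: big1 => r _; rewrite y0 scaler0.
  transitivity (\sum_k (\sum_r invmx P l r * P r k) *: tens_row T k).
    rewrite (bigD1 l) //= PV eqxx scale1r big1 ?addr0 // => k kl.
    by rewrite PV eq_sym (negbTE kl) scale0r.
  under eq_bigr do rewrite scaler_suml.
  rewrite exchange_big; apply: eq_bigr => r _; rewrite scaler_sumr.
  by apply: eq_bigr => k _; rewrite scalerA.
rewrite (tens_rowE T) big1 // => i _; rewrite c0.
by apply/matrixP => a b; rewrite tensE linear0 !mxE mulr0.
Qed.

End PsiForm.

Lemma comult_adjoint (Q : quantumSpace) : mult_adjoint (qs_psi Q) (@comult Q).
Proof. by rewrite /comult; case: cid2. Qed.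

Lemma mult_comult (Q : quantumSpace) (x : Q) :
  mult (comult x) = ((qs_delta Q ^+ 2)%:C)%C *: x.
Proof. by move: x; rewrite /comult; case: cid2. Qed.

Lemma mult_tens (B : fdCstarType R) (x y : B) : mult (tens x y) = x ∙ y.
Proof. exact: (tlift_tens (f := @cmul R B) _ _ (cmul_bilin B)). Qed.

Definition complete_adj (Q : quantumSpace) (x : Q) : Q :=
  (((qs_delta Q ^+ 2)%:C)%C * qs_psi Q x) *: cone.

Lemma complete_adj_is_linear (Q : quantumSpace) : linear (@complete_adj Q).
Proof.
move=> a x y; rewrite /complete_adj linearD linearZ /= mulrDr scalerDl scalerA.
by rewrite mulrCA.
Qed.
HB.instance Definition _ (Q : quantumSpace) :=
  GRing.isLinear.Build R[i] Q Q _ (@complete_adj Q) (@complete_adj_is_linear Q).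

Lemma psi2_ip_tens (B : fdCstarType R) (psi : {scalar B}) (a b c d : B) :
  psi2_ip psi (tens a b) (tens c d) = psi_ip psi a c * psi_ip psi b d.
Proof.
apply: tsesq_tens => [x y|t x y z u|t x y z u].
- split=> [w|w] p v z.
    by rewrite psi_ip_linr mulrDl -mulrA.
  by rewrite psi_ip_linr mulrDr mulrCA.
- by apply/funext => v; rewrite psi_ip_linl mulrDl -mulrA.
- by apply/funext => v; rewrite psi_ip_linl mulrDr mulrCA.
Qed.

Lemma complete_adjP (Q : quantumSpace) (x : Q) :
  mult (tmap (@complete_adj Q) (@complete_adj Q) (comult x))
  = ((qs_delta Q ^+ 2)%:C)%C *: complete_adj x.
Proof.
set d2 := ((qs_delta Q ^+ 2)%:C)%C.
have key (T : tensor Q Q) : mult (tmap (@complete_adj Q) (@complete_adj Q) T) =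
    (d2 ^+ 2 * psi2_ip (qs_psi Q) (tens cone cone) T) *: (cone : Q).
  move: T; apply: tens_ext.
  - by move=> a S T; rewrite tmap_is_linear; exact: tlift_is_linear.
  - move=> a S T; rewrite [X in _ * X]tsesq_linear mulrDr scalerDl scalerA.
    by rewrite [a * _]mulrCA.
  move=> v w; rewrite tmap_tens; try exact: complete_adj_is_linear.
  rewrite mult_tens psi2_ip_tens /psi_ip cone_star !c1mul /complete_adj -/d2.
  by rewrite cmulZl cmulZr c1mul scalerA mulrACA expr2.
rewrite key -comult_adjoint mult_tens /psi_ip c1mul cone_star c1mul.
by rewrite /complete_adj scalerA mulrA expr2.
Qed.

Definition complete_graph (Q : quantumSpace) : quantumGraph :=
  @QuantumGraph Q (@complete_adj Q) (@complete_adjP Q).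

Section EdgeCorrespondence.
Variable G : quantumGraph.

Let state := qs_state G.

Definition edge_generator : tensor G G :=
  ((qs_delta G ^- 2)%:C)%C *: tmap id (qg_adj G) (comult (cone : G)).

(* x ⊗ y |-> x · ε · y; its image is the span of the elements x · ε · y. *)
Definition edge_map : tensor G G -> tensor G G :=
  tlift (fun x y => edge_ract (edge_lact x edge_generator) y).
HB.instance Definition _ := GRing.Linear.on edge_map.

Definition edge_space : {vspace tensor G G} := limg (linfun edge_map).

Lemma edge_map_tens (x y : G) :
  edge_map (tens x y) = edge_ract (edge_lact x edge_generator) y.
Proof.
apply: tlift_tens; split=> [w|w] a u v.
  by rewrite edge_lact_linl edge_ract_linl.
by rewrite edge_ract_linr.
Qed.

Lemma edge_spaceP (T : tensor G G) :
  reflect (exists s : seq (G * G),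
    T = \sum_(p <- s) edge_ract (edge_lact p.1 edge_generator) p.2)
  (T \in edge_space).
Proof.
apply: (iffP memv_imgP) => [[S _ ->]|[s ->]].
  exists [seq (S ij.1 ij.2 *: tbasis ij.1 : G, tbasis ij.2 : G) |
          ij : 'I_(dim G) * 'I_(dim G)].
  rewrite lfunE big_map big_enum /= [S in LHS]tens_expand pair_big linear_sum /=.
  apply: eq_bigr => p _; rewrite -edge_map_tens; congr (edge_map _).
  by apply/matrixP=> i j; rewrite [LHS]mxE !tensE linearZ mxE mulrA.
exists (\sum_(p <- s) tens p.1 p.2); first exact: memvf.
rewrite lfunE linear_sum; apply: eq_bigr => p _; exact/esym/edge_map_tens.
Qed.

Lemma edge_lact_map (x : G) T : edge_lact x (edge_map T) = edge_map (edge_lact x T).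
Proof.
move: T; apply: tens_ext => [a S T|a S T|c d].
- by rewrite linearP edge_lact_linr.
- by rewrite edge_lact_linr linearP.
by rewrite edge_lact_tens !edge_map_tens edge_lract edge_lactM.
Qed.

Lemma edge_ract_map (y : G) T : edge_ract (edge_map T) y = edge_map (edge_ract T y).
Proof.
move: T; apply: tens_ext => [a S T|a S T|c d].
- by rewrite linearP edge_ract_linl.
- by rewrite edge_ract_linl linearP.
by rewrite edge_ract_tens !edge_map_tens edge_ractM.
Qed.

Lemma edge_lact_mem (x : G) T : T \in edge_space -> edge_lact x T \in edge_space.
Proof.
by move=> /memv_imgP[S _ ->]; apply/memv_imgP; exists (edge_lact x S);
   rewrite ?memvf // !lfunE /= edge_lact_map.
Qed.

Lemma edge_ract_mem (y : G) T : T \in edge_space -> edge_ract T y \in edge_space.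
Proof.
by move=> /memv_imgP[S _ ->]; apply/memv_imgP; exists (edge_ract S y);
   rewrite ?memvf // !lfunE /= edge_ract_map.
Qed.

Definition esub_lact (x : G) (xi : subvs_of edge_space) : subvs_of edge_space :=
  Subvs (edge_lact_mem x (subvsP xi)).
Definition esub_ract (xi : subvs_of edge_space) (y : G) : subvs_of edge_space :=
  Subvs (edge_ract_mem y (subvsP xi)).
Definition esub_ip (xi eta : subvs_of edge_space) : G :=
  edge_ip (qs_psi G) (vsval xi) (vsval eta).

Lemma esub_complete (u : nat -> subvs_of edge_space) :
  (forall e : R[i], 0 < e -> exists N, forall m n,
     (N <= m)%N -> (N <= n)%N -> hilbert_norm esub_ip (u m - u n) < e) ->
  exists l, forall e : R[i], 0 < e -> exists N, forall n,
     (N <= n)%N -> hilbert_norm esub_ip (u n - l) < e.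
Proof.
apply: finite_dim_complete => [a xi eta zeta|a xi eta zeta|xi].
- by rewrite /esub_ip linearP edge_ip_linr.
- by rewrite /esub_ip linearP edge_ip_linl.
by move=> /(edge_ip_def state) xi0; apply: val_inj; rewrite /= xi0.
Qed.

Lemma esub_ract_linl (a : R[i]) xi eta y :
  esub_ract (a *: xi + eta) y = a *: esub_ract xi y + esub_ract eta y.
Proof. by apply: val_inj; rewrite /= edge_ract_linl. Qed.

Lemma esub_ract_linr (a : R[i]) xi (x y : G) :
  esub_ract xi (a *: x + y) = a *: esub_ract xi x + esub_ract xi y.
Proof. by apply: val_inj; rewrite /= edge_ract_linr. Qed.

Lemma esub_ractM xi (x y : G) :
  esub_ract xi (x ∙ y) = esub_ract (esub_ract xi x) y.
Proof. by apply: val_inj; rewrite /= edge_ractM. Qed.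

Lemma esub_ip_linr (a : R[i]) xi eta zeta :
  esub_ip xi (a *: eta + zeta) = a *: esub_ip xi eta + esub_ip xi zeta.
Proof. by rewrite /esub_ip linearP edge_ip_linr. Qed.

Lemma esub_ip_ract xi eta (y : G) :
  esub_ip xi (esub_ract eta y) = esub_ip xi eta ∙ y.
Proof. by rewrite /esub_ip /= edge_ip_ract. Qed.

Lemma esub_ip_star xi eta : (esub_ip xi eta)^† = esub_ip eta xi.
Proof. by rewrite /esub_ip edge_ip_star. Qed.

Lemma esub_ip_pos xi : cpositive (esub_ip xi xi).
Proof. exact: edge_ip_pos. Qed.

Lemma esub_ip_def xi : esub_ip xi xi = 0 -> xi = 0.
Proof. by move=> /(edge_ip_def state) xi0; apply: val_inj; rewrite /= xi0. Qed.

Lemma esub_lact_linl (a : R[i]) (x y : G) xi :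
  esub_lact (a *: x + y) xi = a *: esub_lact x xi + esub_lact y xi.
Proof. by apply: val_inj; rewrite /= edge_lact_linl. Qed.

Lemma esub_lact_linr (a : R[i]) (x : G) xi eta :
  esub_lact x (a *: xi + eta) = a *: esub_lact x xi + esub_lact x eta.
Proof. by apply: val_inj; rewrite /= edge_lact_linr. Qed.

Lemma esub_lactM (x y : G) xi :
  esub_lact (x ∙ y) xi = esub_lact x (esub_lact y xi).
Proof. by apply: val_inj; rewrite /= edge_lactM. Qed.

Lemma esub_lact_adj (x : G) xi eta :
  esub_ip (esub_lact x xi) eta = esub_ip xi (esub_lact (x^†) eta).
Proof. by rewrite /esub_ip /= edge_lact_adj. Qed.

Definition edge_correspondence : correspondence G :=
  Correspondence esub_ract_linl esub_ract_linr esub_ractM esub_ip_linr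
    esub_ip_ract esub_ip_star esub_ip_pos esub_ip_def esub_complete
    esub_lact_linl esub_lact_linr esub_lactM esub_lact_adj.

End EdgeCorrespondence.
End QuantumGraphs.

(* Main.v *)
(* The edge generator of K(B, psi) is 1 (x) 1, so E_K is all of B (x)_psi B.  For
   a psi-orthonormal basis e_i of B, the vectors e_i (x) 1 form an orthonormal
   basis of this right module, on which B acts on the left by scalar matrices
   m(x), faithfully and through finite rank operators.  In any covariant
   representation (pi, t) the elements s_i = t(e_i (x) 1) thus form a Cuntz family
   for the unit pi(1), with pi(x) = sum_ij m(x)_ji s_j s_i^* and
   t(zeta) = sum_i s_i pi(<e_i (x) 1, zeta>); conversely these formulas turn a
   Cuntz family into a covariant representation.  The two universal algebras
   therefore map to each other, and both composites fix the generators.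

   Two facts usually taken from spectral theory are obtained by hand.
   *-homomorphisms are bounded because a self-adjoint element of norm at most 1/2
   is an average of two unitaries.  The range projections of a Cuntz family are
   orthogonal because a nonzero self-adjoint a cannot satisfy both
   |1 + a| <= 1 and |1 - a| <= 1. *)

Require Import Defs.
From HB Require Import structures.
From mathcomp Require Import all_boot all_order all_algebra.
From mathcomp Require Import complex ring.
From mathcomp Require Import boolp classical_sets reals topology normedtype.

Set Implicit Arguments.
Unset Strict Implicit.
Unset Printing Implicit Defensive.

Import Order.TTheory GRing.Theory Num.Theory numFieldNormedType.Exports.
Import VectorInternalTheory.

Local Open Scope ring_scope.
Local Open Scope cstar_scope.

(** * Limits and closed sets in normed modules over [R[i]] *)

Section NormedModules.
Variable R : realType.

Lemma RRe_ge0 (r : R[i]) : 0 <= r -> r = ((complex.Re r)%:C)%C.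
Proof. by move=> r0; rewrite RRe_real // ger0_real. Qed.

(** The Archimedean property of [R], applied to real parts. Later an identity for a limit is proved
    by bounding n times the norm of its defect. *)
Lemma arch_norm_eq0 (V : normedModType R[i]) (x : V) (M : R[i]) :
  (forall n : nat, n%:R * `|x| <= M) -> x = 0.
Proof.
move=> h; apply/eqP; rewrite -normr_eq0; apply/negPn/negP => xn.
have M0 : 0 <= M by have := h 0; rewrite mul0r.
have nE := RRe_ge0 (normr_ge0 x).
have r0 : 0 < complex.Re `|x| by rewrite -ltcR -nE lt_def xn normr_ge0.
have q0 : 0 <= complex.Re M / complex.Re `|x|.
  by rewrite divr_ge0 ?(ltW r0) // -lecR -RRe_ge0.
have := archi_boundP q0; set n := Num.bound _; rewrite ltr_pdivrMr // => hn.
have := h n; rewrite (RRe_ge0 M0) nE -(rmorph_nat (real_complex R)) -rmorphM lecR.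
by rewrite leNgt hn.
Qed.

(** A point x of the closure is within 1/n of some zero y, so |f x| = |f (x - y)| <= M/n. This
    supplies the closed sets for [generates]. *)
Lemma closed_bounded_kernel (V W : normedModType R[i]) (f : V -> W) (M : R[i]) :
  (forall x y, f (x - y) = f x - f y) -> 0 <= M ->
  (forall x, `|f x| <= M * `|x|) -> closed [set x | f x = 0]%classic.
Proof.
move=> fB M0 fM x cx; apply: (@arch_norm_eq0 _ _ M) => -[|n].
  by rewrite mul0r.
have n0 : 0 < n.+1%:R^-1 :> R[i] by rewrite invr_gt0 ltr0n.
have [y []] := cx _ (nbhsx_ballx x _ n0).
rewrite /= -ball_normE /= => y0 xy.
have := fM (x - y); rewrite fB y0 subr0 => /le_trans h.
rewrite mulrC -ler_pdivlMr ?ltr0n //; apply: h.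
by rewrite ler_wpM2l // ltW.
Qed.

(** Some late term is within 2^-n of both [u n] and the limit, whence the constant 2. *)
Lemma geometric_cauchy_limit (V : completeNormedModType R[i]) (u : nat -> V) :
  (forall n k, 2 ^+ n * `|u (n + k)%N - u n| <= 1) ->
  exists l, forall n, 2 ^+ n * `|u n - l| <= 2.
Proof.
move=> cu.
have pow0 n : 0 < 2 ^+ n :> R[i] by rewrite exprn_gt0.
have small (e : R[i]) : 0 < e -> exists n, (2 ^+ n)^-1 < e.
  move=> e0; have eE := RRe_ge0 (ltW e0).
  have e1 : 0 < complex.Re e by rewrite -ltcR -eE.
  have e2 : 0 <= (complex.Re e)^-1 by rewrite invr_ge0 ltW.
  exists (Num.bound (complex.Re e)^-1); rewrite eE invf_plt ?posrE -?eE //.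
  rewrite {1}eE -fmorphV -(rmorph_nat (real_complex R)) -rmorphXn ltcR.
  by rewrite (lt_trans (archi_boundP e2)) // -natrX ltr_nat ltn_expl.
have cvu : cvg (u @ \oo)%classic.
  apply/cauchy_cvgP/cauchy_exP => e e0; have [N hN] := small _ e0.
  exists (u N); exists N => // n /= Nn; rewrite -ball_normE /= distrC.
  apply: le_lt_trans hN; rewrite -(subnKC Nn) -[leLHS](mulKf (lt0r_neq0 (pow0 N))).
  by rewrite ler_piMr ?cu // invr_ge0 ltW.
exists (lim (u @ \oo)%classic) => n.
have n0 : 0 < (2 ^+ n)^-1 :> R[i] by rewrite invr_gt0.
move/cvgrPdist_lt: cvu => /(_ _ n0)[N _ uN].
have := uN (n + N)%N (leq_addl _ _); rewrite /= => lt1.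
rewrite -ler_pdivlMl // (le_trans (ler_distD (u (n + N)%N) _ _)) //.
rewrite mulr2n mulrDr mulr1 lerD //; last by rewrite distrC ltW.
by rewrite -[leRHS]mulr1 ler_pdivlMl // distrC.
Qed.

End NormedModules.

(** * Elementary identities and norms in C*-algebras *)

Section CStarTheory.
Variables (R : realType) (A : cstarType R).
Implicit Types x y z : A.

Lemma cmulNl x y : (- x) ∙ y = - (x ∙ y).
Proof. by rewrite -scaleN1r cmulZl scaleN1r. Qed.
Lemma cmulNr x y : x ∙ (- y) = - (x ∙ y).
Proof. by rewrite -scaleN1r cmulZr scaleN1r. Qed.
Lemma cmulBl x y z : (x - y) ∙ z = x ∙ z - y ∙ z.
Proof. by rewrite cmulDl cmulNl. Qed.
Lemma cmulBr x y z : z ∙ (x - y) = z ∙ x - z ∙ y.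
Proof. by rewrite cmulDr cmulNr. Qed.
Lemma cstarN x : (- x)^† = - x^†.
Proof. by rewrite -scaleN1r cstarZ rmorphN1 scaleN1r. Qed.
Lemma cstarB x y : (x - y)^† = x^† - y^†.
Proof. by rewrite cstarD cstarN. Qed.

Lemma cstar_mul_eq0 x : x^† ∙ x = 0 -> x = 0.
Proof.
move=> x0; have := cnorm_star x; rewrite x0 normr0 => /esym/eqP.
by rewrite expf_eq0 /= normr_eq0 => /eqP.
Qed.

Lemma cnormV x : `|x^†| = `|x|.
Proof.
have le z : `|z| <= `|z^†|.
  have [->|z0] := eqVneq z 0; first by rewrite normr0.
  have := cnormM z^† z; rewrite cnorm_star expr2 ler_pM2r // normr_gt0 //.
by apply/le_anti; rewrite le andbT (le_trans (le _)) ?cstarK.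
Qed.

Lemma projection_norm_le1 x : x^† ∙ x = x -> `|x| <= 1.
Proof.
move=> xx; have := cnorm_star x; rewrite xx => h.
have [->|x0] := eqVneq x 0; first by rewrite normr0.
have : `|x| * 1 = `|x| * `|x| by rewrite mulr1 [LHS]h expr2.
by move/mulfI => <- //; rewrite normr_eq0.
Qed.

End CStarTheory.

(** * Square roots by fixed-point iteration, and unitaries *)

Section UnitalTheory.
Variables (R : realType) (A : unitalCstarType R).
Implicit Types a x y z : A.

Lemma cone_norm_le1 : `|cone : A| <= 1.
Proof. by apply: projection_norm_le1; rewrite cmul1 cone_star. Qed.

(* Makes 1 - y a square root of 1 - x. *)
Lemma half_fixed_point a x : x^† = x -> a ∙ x = x ∙ a -> `|x| <= 2^-1 ->
  exists y, [/\ y^† = y, a ∙ y = y ∙ a & y + y = x + y ∙ y].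
Proof.
move=> xs ax xle; set q : R[i] := 2^-1 in xle *.
have q0 : 0 <= q by rewrite invr_ge0.
have q2 : q + q = 1 by rewrite -mulr2n -mulr_natl mulfV ?pnatr_eq0.
have q1 : q <= 1 by rewrite -q2 lerDl.
have qq : q * q <= q by rewrite ler_piMr.
(* The fixed points of [phi] are the solutions of y + y = x + y y. On the ball of radius 1/2, which
   [phi] preserves, it contracts distances by 1/2. *)
pose phi y := q *: (x + y ∙ y); pose u n := iter n phi 0.
have phiB y z : `|phi y - phi z| <= q * ((`|y| + `|z|) * `|y - z|).
  rewrite -scalerBr normrZ ger0_norm // ler_wpM2l // opprD addrACA subrr add0r.
  have -> : y ∙ y - z ∙ z = y ∙ (y - z) + (y - z) ∙ z.
    by rewrite cmulBr cmulBl addrA subrK.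
  rewrite (le_trans (ler_normD _ _)) // mulrDl lerD // (le_trans (cnormM _ _)) //.
  by rewrite mulrC.
have u_le n : `|u n| <= q.
  elim: n => [|n IH]; first by rewrite normr0.
  rewrite /= normrZ ger0_norm // ler_piMr // -q2 (le_trans (ler_normD _ _)) //.
  rewrite lerD // (le_trans (cnormM _ _)) // (le_trans _ qq) //.
  by rewrite ler_pM.
have u_cauchy n k : 2 ^+ n * `|u (n + k)%N - u n| <= 1.
  elim: n => [|n IH]; first by rewrite mul1r subr0 (le_trans (u_le _)).
  apply: le_trans IH; rewrite exprSr -mulrA ler_wpM2l ?exprn_ge0 //.
  rewrite mulrC -ler_pdivlMr // mulrC -/q (le_trans (phiB _ _)) // ler_wpM2l //.
  by rewrite ler_piMl // -q2 lerD.
have [l ul] := geometric_cauchy_limit u_cauchy.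
(* Closed linear conditions pass from the iterates to [l]: n |f l| <= 2^n |f (u n - l)| <= 2 M. *)
have lim0 (f : A -> A) M : (forall y z, f (y - z) = f y - f z) -> 0 <= M ->
    (forall y, `|f y| <= M * `|y|) -> (forall n, f (u n) = 0) -> f l = 0.
  move=> fB M0 fM fu; apply: (@arch_norm_eq0 _ _ _ (M * 2)) => n.
  have -> : `|f l| = `|f (u n - l)| by rewrite fB fu sub0r normrN.
  apply: le_trans (_ : 2 ^+ n * (M * `|u n - l|) <= _).
    by rewrite ler_pM // -natrX ler_nat ltnW // ltn_expl.
  by rewrite mulrCA ler_wpM2l // ul.
exists l; split.
- apply/eqP; rewrite -subr_eq0; apply/eqP.
  apply: (lim0 (fun y => y^† - y) 2) => // [y z|y|n].
  + by rewrite cstarB opprD addrACA opprD.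
  + by rewrite (le_trans (ler_normB _ _)) // cnormV mulr2n mulrDl mul1r.
  by apply/eqP; rewrite subr_eq0; apply/eqP; elim: n => [|n IH] /=;
     rewrite ?cstar0 // cstarZ cstarD cstarM IH xs geC0_conj.
- apply/eqP; rewrite -subr_eq0; apply/eqP.
  apply: (lim0 (fun y => a ∙ y - y ∙ a) (`|a| + `|a|)) => // [y z||y|n].
  + by rewrite cmulBl cmulBr opprD addrACA opprD.
  + by rewrite addr_ge0.
  + rewrite (le_trans (ler_normB _ _)) // mulrDl lerD ?cnormM //.
    by rewrite mulrC cnormM.
  apply/eqP; rewrite subr_eq0; apply/eqP; elim: n => [|n IH] /=.
    by rewrite cmul0l cmul0r.
  by rewrite cmulZl cmulZr cmulDl cmulDr ax cmulA IH -cmulA IH cmulA.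
have phil : phi l = l.
  apply/eqP; rewrite -subr_eq0; apply/eqP.
  (* Compare both sides with phi (u n) = u (n+1). Since |l| <= 2, [phi] expands the distance from
     [u n] to [l] at most by the factor 2. *)
  apply: (@arch_norm_eq0 _ _ _ (2 * 2 + 2)) => n.
  apply: le_trans (_ : 2 ^+ n * `|phi l - l| <= _).
    by rewrite ler_wpM2r // -natrX ler_nat ltnW // ltn_expl.
  have l2 : `|l| <= 2 by have := ul 0; rewrite mul1r sub0r normrN.
  apply: le_trans (_ : 2 ^+ n * (2 * `|u n - l| + `|u n.+1 - l|) <= _).
    rewrite ler_wpM2l ?exprn_ge0 // (le_trans (ler_distD (phi (u n)) _ _)) //.
    rewrite lerD // (le_trans (phiB _ _)) // distrC mulrA ler_wpM2r //.
    rewrite mulrDr mulr2n lerD //.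
      by rewrite mulrC -ler_pdivlMr ?invr_gt0 // invrK mul1r.
    by rewrite (le_trans (ler_pM _ _ q1 (u_le n))) // mul1r.
  rewrite mulrDr lerD //; first by rewrite mulrCA ler_wpM2l // ul.
  by apply: le_trans (ul n.+1); rewrite ler_wpM2r // ler_weXn2l // ler1n.
by rewrite -[X in X + _]phil -[X in _ + X]phil -scalerDl q2 scale1r.
Qed.

(** Take u = a + i c, where c is a self-adjoint square root of 1 - a^2 commuting with a; then u^† u
    = a^2 + c^2 = 1. *)
Lemma unitary_decomposition a : a^† = a -> `|a| <= 2^-1 ->
  exists u : A, u^† ∙ u = cone /\ u + u^† = 2 *: a.
Proof.
move=> as_ ale.
have ale1 : `|a| <= 1 by rewrite (le_trans ale) // invf_le1 // ler1n.
have [||y [ys ay yy]] := @half_fixed_point a (a ∙ a) _ (cmulA _ _ _).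
- by rewrite cstarM as_.
- by rewrite (le_trans (cnormM _ _)) // (le_trans (ler_piMr _ ale1)).
pose c : A := cone - y.
have cs : c^† = c by rewrite cstarB cone_star ys.
have ac : a ∙ c = c ∙ a by rewrite cmulBl cmulBr cmul1 c1mul ay.
have cc : c ∙ c = cone - a ∙ a.
  rewrite cmulBl !cmulBr !(c1mul, cmul1) opprB addrCA -addrA -opprD yy.
  by rewrite opprD addrCA [- _ - _]addrC addNKr.
exists (a + 'i *: c); rewrite cstarD cstarZ as_ cs conjCi; split; last first.
  by rewrite scaleNr addrACA subrr addr0 scaler_nat mulr2n.
rewrite cmulDl !cmulDr !cmulZl !cmulZr ac scalerA mulNr -expr2 sqrCi opprK.
by rewrite scale1r cc scaleNr addrA addrK addrCA subrr addr0.
Qed.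

End UnitalTheory.

(** * Boundedness of *-homomorphisms and their fixed points *)

Section StarHomomorphisms.
Variables (R : realType) (A : unitalCstarType R) (D : cstarType R) (f : A -> D).
Hypothesis fhom : starhom f.

Lemma starhomB x y : f (x - y) = f x - f y.
Proof.
by case: fhom => lin _ _; rewrite addrC -scaleN1r lin scaleN1r addrC.
Qed.

Lemma starhom0 : f 0 = 0.
Proof. by rewrite -(subrr 0) starhomB subrr. Qed.

Lemma starhomD x y : f (x + y) = f x + f y.
Proof. by case: fhom => lin _ _; rewrite -[x]scale1r lin !scale1r. Qed.

Lemma starhomZ (a : R[i]) x : f (a *: x) = a *: f x.
Proof. by case: fhom => lin _ _; rewrite -[_ *: _]addr0 lin starhom0 addr0. Qed.

Lemma starhom_sum (I : Type) (r : seq I) (F : I -> A) :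
  f (\sum_(i <- r) F i) = \sum_(i <- r) f (F i).
Proof. exact: (big_morph f starhomD starhom0). Qed.

(* A self-adjoint element of norm at most 1/2 is an average of two unitaries,
   and unitaries are mapped to partial isometries. *)
Lemma starhom_bounded x : `|f x| <= 2 * `|x|.
Proof.
case: fhom => _ fM fstar.
have small a : a^† = a -> `|a| <= 2^-1 -> `|f a| <= 1.
  move=> as_ ale; have [u [uu ua]] := unitary_decomposition as_ ale.
  have fu : `|f u| <= 1.
    rewrite -(@ler_pXn2r _ 2) ?nnegrE // expr1n -cnorm_star -fstar -fM uu.
    by apply: projection_norm_le1; rewrite -fstar -fM cmul1 cone_star.
  have : `|2 *: f a| <= 1 + 1.
    by rewrite -starhomZ -ua starhomD (le_trans (ler_normD _ _)) // lerD // fstar cnormV.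
  by rewrite normrZ normr_nat -[leRHS]mulr1 -[1 + 1]/2 ler_pM2l.
have selfadj a : a^† = a -> `|f a| <= 2 * `|a|.
  move=> as_; have [->|a0] := eqVneq a 0; first by rewrite starhom0 !normr0 mulr0.
  have n0 : 0 < `|a| by rewrite normr_gt0.
  pose t : R[i] := (2 * `|a|)^-1.
  have t0 : 0 < t by rewrite invr_gt0 mulr_gt0.
  have := @small (t *: a); rewrite cstarZ as_ geC0_conj ?(ltW t0) // starhomZ !normrZ.
  rewrite gtr0_norm // => /(_ erefl) h.
  have : t * `|f a| <= 1 by apply: h; rewrite /t invfM mulfVK // gt_eqF.
  by rewrite /t ler_pdivrMl ?mulr_gt0 // mulr1.
(* The C*-identity reduces to the self-adjoint x^† x: |f x|^2 = |f (x^† x)| <= 2 |x|^2 <= (2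
   |x|)^2. *)
rewrite -(@ler_pXn2r _ 2) ?nnegrE ?mulr_ge0 // -cnorm_star -fstar -fM.
rewrite (le_trans (selfadj _ _)) ?cstarM ?cstarK // cnorm_star exprMn.
by rewrite ler_wpM2r ?exprn_ge0 // expr2 ler_peMl // ler1n.
Qed.

End StarHomomorphisms.

(** The fixed points of [f] form a *-subalgebra, closed because f - id is bounded by 2 + 1. *)
Lemma starhom_id (R : realType) (A : unitalCstarType R) (f : A -> A)
    (S : set A) : starhom f -> generates S -> (forall x, S x -> f x = x) ->
  forall x, f x = x.
Proof.
move=> fhom genS fS x.
have [_ fM fstar] := fhom.
suff H : [set x | f x - x = 0]%classic = setT.
  have : [set x | f x - x = 0]%classic x by rewrite H.
  by move=> /eqP; rewrite subr_eq0 => /eqP.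
apply: genS => /=.
- apply: (@closed_bounded_kernel _ _ _ _ 3) => // [y z|y].
    by rewrite starhomB // opprD addrACA opprD.
  rewrite (le_trans (ler_normB _ _)) // (natrD _ 2 1) mulrDl mul1r lerD //.
  exact: starhom_bounded.
- by move=> y /fS /= ->; rewrite subrr.
- by rewrite starhom0 // subr0.
- move=> a y z /eqP + /eqP; rewrite !subr_eq0 => /eqP fy /eqP fz.
  by rewrite starhomD // starhomZ // fy fz subrr.
- move=> y z /eqP + /eqP; rewrite !subr_eq0 => /eqP fy /eqP fz.
  by rewrite fM fy fz subrr.
- move=> y /eqP; rewrite subr_eq0 => /eqP fy.
  by rewrite fstar fy subrr.
Qed.

(** * Orthogonality of the range projections of a Cuntz family *)

Section CuntzFamilies.
Variables (R : realType) (D : unitalCstarType R).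

(* Bernstein's bound: 1 + (N - 1) a^2 is a convex combination of products of
   N factors 1 + a and 1 - a.  The parameter c, the starting point of the
   underlying random walk, makes the induction on N go through. *)
Lemma contractive_segment_sqr0 (a : D) :
  `|cone + a| <= 1 -> `|cone - a| <= 1 -> a ∙ a = 0.
Proof.
move=> le1 le2.
pose comb (al be ga de : R[i]) : D :=
  al *: cone + be *: a + ga *: (a ∙ a) + de *: (a ∙ (a ∙ a)).
have combZ r al be ga de :
    r *: comb al be ga de = comb (r * al) (r * be) (r * ga) (r * de).
  by rewrite /comb !scalerDr !scalerA.
have combD al be ga de al' be' ga' de' :
    comb al be ga de + comb al' be' ga' de' =
    comb (al + al') (be + be') (ga + ga') (de + de').
  rewrite /comb !scalerDl addrACA; congr (_ + _).
  by rewrite addrACA; congr (_ + _); rewrite addrACA.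
have combN al be ga de : - comb al be ga de = comb (- al) (- be) (- ga) (- de).
  by rewrite -scaleN1r combZ !mulN1r.
have combM al be ga : a ∙ comb al be ga 0 = comb 0 al be ga.
  by rewrite /comb !cmulDr !cmulZr cmul1 !scale0r addr0 add0r.
(* [E N c] is the mean, over independent signs e_1, ..., e_N, of (c + e_1 + ... + e_N)^2 (1 + e_1 a)
   ... (1 + e_N a). Its norm is at most the mean of the squares, N + c^2; the induction conditions
   on one sign. *)
pose E (N : nat) (c : R[i]) : D :=
  comb (N%:R + c ^+ 2) (2 * c * N%:R) (N%:R * (N%:R - 1)) 0.
have E_le N c : c \is Num.real -> `|E N c| <= N%:R + c ^+ 2.
  elim: N c => [|N IH] c cr.
    rewrite /E /comb !mul0r !mulr0 !scale0r !addr0 add0r normrZ.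
    have c2 : 0 <= c ^+ 2 by rewrite real_exprn_even_ge0.
    by rewrite ger0_norm // ler_piMr // cone_norm_le1.
  have -> : E N.+1 c = 2^-1 *:
      ((cone + a) ∙ E N (c + 1) + (cone - a) ∙ E N (c - 1)).
    rewrite cmulDl cmulBl !c1mul !combM combN !combD combZ /E -natr1.
    by congr (comb _ _ _ _); field.
  rewrite normrZ ger0_norm ?invr_ge0 // mulrC ler_pdivrMr //.
  have -> : (N.+1%:R + c ^+ 2) * 2 =
      (N%:R + (c + 1) ^+ 2) + (N%:R + (c - 1) ^+ 2) by rewrite -natr1; ring.
  rewrite (le_trans (ler_normD _ _)) // lerD // (le_trans (cnormM _ _)) //.
    by rewrite (le_trans _ (IH _ _)) ?ler_piMl // rpredD ?real1.
  by rewrite (le_trans _ (IH _ _)) ?ler_piMl // rpredB ?real1.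
(* For c = 0 and N = n + 1 the bound reads |N 1 + N n a^2| <= N, so n |a^2| <= 2. *)
apply: (@arch_norm_eq0 _ _ _ 2) => n.
have := E_le n.+1 0 (real0 _).
rewrite /E /comb expr0n addr0 mulr0 mul0r !scale0r !addr0.
rewrite (_ : n.+1%:R - 1 = n%:R) => [h|]; last by rewrite -natr1 addrK.
have N0 : 0 < n.+1%:R :> R[i] by rewrite ltr0n.
rewrite -(ler_pM2l N0) mulrA.
have -> : n.+1%:R * n%:R * `|a ∙ a| = `|(n.+1%:R * n%:R) *: (a ∙ a)|.
  by rewrite normrZ ger0_norm // mulr_ge0.
rewrite -[X in `|X|](addKr (n.+1%:R *: cone)) (le_trans (ler_normD _ _)) //.
rewrite normrN [leRHS]mulr_natr mulr2n lerD // normrZ ger0_norm // ler_piMr //.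
exact: cone_norm_le1.
Qed.

(** The bound |1 - b| <= 1 stands in for positivity. With M the number of indices in [P], M 1 - b_i
    is (M - 1) 1 plus 1 - b_i, and M 1 + b_i is 1 plus the sum of 1 - b_k over the other k; both
    have norm at most M, so b_i / M squares to 0. *)
Lemma sum_positive_contractions_eq0 (I : finType) (P : pred I) (b : I -> D) :
  (forall i, (b i)^† = b i) -> (forall i, `|cone - b i| <= 1) ->
  \sum_(i | P i) b i = 0 -> forall i, P i -> b i = 0.
Proof.
move=> bs ble b0 i Pi; apply: cstar_mul_eq0; rewrite bs.
pose others := [pred k | P k && (k != i)].
pose m : R[i] := #|others|%:R; pose M := m + 1.
have m0 : 0 <= m by [].
have M0 : 0 < M by rewrite ltr_wpDl.
have bi : - b i = \sum_(k in others) b k.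
  by rewrite -[RHS](addKr (b i)) -bigD1 // b0 addr0.
have le1 : `|M *: cone - b i| <= M.
  rewrite scalerDl scale1r -addrA (le_trans (ler_normD _ _)) // lerD //.
  by rewrite normrZ ger0_norm // ler_piMr // cone_norm_le1.
have le2 : `|M *: cone + b i| <= M.
  rewrite -[b i]opprK bi scalerDl scale1r addrAC (le_trans (ler_normD _ _)) //.
  rewrite lerD ?cone_norm_le1 // /m scaler_nat -sumr_const -sumrB.
  by rewrite (le_trans (ler_norm_sum _ _ _)) // -sumr_const ler_sum.
have Mn (x : D) : `|M *: x| <= M -> `|x| <= 1.
  by rewrite normrZ gtr0_norm // -[X in _ <= X -> _]mulr1 ler_pM2l.
have : (M^-1 *: b i) ∙ (M^-1 *: b i) = 0.
  apply: contractive_segment_sqr0; apply: Mn.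
    by rewrite scalerDr scalerA mulfV ?gt_eqF // scale1r.
  by rewrite scalerBr scalerA mulfV ?gt_eqF // scale1r.
rewrite cmulZl cmulZr scalerA => /eqP; rewrite scaler_eq0 mulf_eq0 invr_eq0.
by rewrite gt_eqF //= => /eqP.
Qed.

Variables (n : nat) (s : 'I_n -> D).
Hypothesis fam : cuntz_family s.

(** The elements b_k = s_j^† s_k s_k^† s_j sum to s_j^† s_j = 1 = b_j, so those with k != j sum to
    0; and 1 - b_k is a compression of the projection 1 - s_k s_k^†. *)
Lemma cuntz_orthonormal i j : (s i)^† ∙ s j = (i == j)%:R *: cone.
Proof.
have [iso sum1] := fam.
have [->|ij] := eqVneq i j; first by rewrite iso scale1r.
rewrite scale0r; apply: cstar_mul_eq0; move: i ij.
have norm_s k : `|s k| <= 1.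
  by rewrite -(@ler_pXn2r _ 2) ?nnegrE // expr1n -cnorm_star iso cone_norm_le1.
pose b k := ((s k)^† ∙ s j)^† ∙ ((s k)^† ∙ s j).
have bE k : b k = (s j)^† ∙ (s k ∙ (s k)^†) ∙ s j.
  by rewrite /b cstarM cstarK !cmulA.
apply: (@sum_positive_contractions_eq0 _ (fun k => k != j) b) => [k|k|].
- by rewrite /b cstarM cstarK.
- have -> : cone - b k = (s j)^† ∙ (cone - s k ∙ (s k)^†) ∙ s j.
    by rewrite cmulBr cmul1 cmulBl iso bE.
  rewrite (le_trans (cnormM _ _)) // mulr_ile1 //.
  rewrite (le_trans (cnormM _ _)) // mulr_ile1 ?cnormV //.
  apply: projection_norm_le1; rewrite cstarB cone_star cstarM cstarK.
  rewrite cmulBr cmul1 cmulBl c1mul -cmulA (cmulA _ (s k)) iso c1mul subrr.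
  by rewrite subr0.
have : \sum_k b k = cone.
  under eq_bigr do rewrite bE.
  by rewrite -cmul_suml -cmul_sumr sum1 cmul1 iso.
rewrite (bigD1 j) //= {1}/b iso cone_star cmul1 => /eqP.
by rewrite -[X in _ == X]addr0 (inj_eq (addrI _)) => /eqP.
Qed.

Lemma cuntz_ext (x y : D) : (forall i, x ∙ s i = y ∙ s i) -> x = y.
Proof.
move=> xy; have [_ sum1] := fam; rewrite -[x]cmul1 -[y]cmul1 -sum1 !cmul_sumr.
by apply: eq_bigr => i _; rewrite !cmulA xy.
Qed.

End CuntzFamilies.

(* The ignored proofs let the unit be inferred from the type. *)
Definition with_unit (R : realType) (A : cstarType R) (p : A)
    (_ : right_id p (@cmul R A)) (_ : left_id p (@cmul R A)) : Type := A.

Section WithUnit.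
Variables (R : realType) (A : cstarType R) (p : A).
Hypotheses (p1 : right_id p (@cmul R A)) (p2 : left_id p (@cmul R A)).

HB.instance Definition _ := CStarAlgebra.on (with_unit p1 p2).
HB.instance Definition _ := hasCOne.Build R (with_unit p1 p2) p1 p2.

End WithUnit.

(** * Adjointable operators and representations of a correspondence *)

Section CorrespondenceTheory.
Variables (R : realType) (B : cstarType R) (X : correspondence B).
Implicit Types (zeta eta : X) (T S : X -> X).

Lemma ip0r zeta : ip zeta 0 = 0.
Proof.
by have := ip_linr (-1) zeta 0 0; rewrite scaler0 addr0 scaleN1r addNr.
Qed.

Lemma ip_sumr (I : Type) (r : seq I) zeta (F : I -> X) :
  ip zeta (\sum_(i <- r) F i) = \sum_(i <- r) ip zeta (F i).
Proof.
apply: (big_morph _ _ (ip0r zeta)) => x y.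
by rewrite -[x]scale1r ip_linr !scale1r.
Qed.

Lemma ip_suml (I : Type) (r : seq I) zeta (F : I -> X) :
  ip (\sum_(i <- r) F i) zeta = \sum_(i <- r) ip (F i) zeta.
Proof.
rewrite -ip_star ip_sumr cstar_sum; apply: eq_bigr => i _; exact: ip_star.
Qed.

Lemma ipZr (a : R[i]) zeta eta : ip zeta (a *: eta) = a *: ip zeta eta.
Proof. by rewrite -[_ *: _]addr0 ip_linr ip0r addr0. Qed.

Lemma ipZl (a : R[i]) zeta eta : ip (a *: zeta) eta = a^* *: ip zeta eta.
Proof. by rewrite -ip_star ipZr cstarZ ip_star. Qed.

Lemma ip_ext zeta eta : (forall omega, ip omega zeta = ip omega eta) -> zeta = eta.
Proof.
move=> h; apply/eqP; rewrite -subr_eq0; apply/eqP/ip_def.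
by rewrite addrC -scaleN1r ip_linr h -[X in _ + X]scale1r -scalerDl addNr scale0r.
Qed.

Lemma ractZr (a : R[i]) zeta b : ract zeta (a *: b) = a *: ract zeta b.
Proof.
by apply: ip_ext => omega; rewrite ipZr !ip_ract cmulZr.
Qed.

Lemma adjoint_pair_sym T S : adjoint_pair T S -> adjoint_pair S T.
Proof. by move=> TS zeta eta; rewrite -ip_star -TS ip_star. Qed.

(** Move [T] to its adjoint inside the inner product: adjointable maps are module maps. *)
Lemma adjoint_ract T S zeta b :
  adjoint_pair T S -> T (ract zeta b) = ract (T zeta) b.
Proof.
move=> /adjoint_pair_sym TS; apply: ip_ext => omega.
by rewrite -TS !ip_ract TS.
Qed.

Lemma adjoint_sum T S (I : Type) (r : seq I) (F : I -> X) :
  adjoint_pair T S -> T (\sum_(i <- r) F i) = \sum_(i <- r) T (F i).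
Proof.
move=> /adjoint_pair_sym TS; apply: ip_ext => omega.
by rewrite -TS !ip_sumr; apply: eq_bigr => i _; rewrite TS.
Qed.

Lemma finite_rank_compact T : finite_rank T -> compact_op T.
Proof.
move=> frT; split; last first.
  move=> e e0; exists T => // zeta.
  by rewrite subrr /hilbert_norm ip0r normr0 sqrtC0 mulr_ge0 ?sqrtC_ge0 // ltW.
case: frT => s ->; exists (fun zeta => \sum_(p <- s) theta p.2 p.1 zeta).
move=> zeta eta; rewrite ip_suml ip_sumr; apply: eq_bigr => p _.
by rewrite /theta ip_ract -ip_star ip_ract cstarM !ip_star.
Qed.

Lemma compact_hom_finite_rank (D : cstarType R) (t : X -> D) Psi (s : seq (X * X)) :
  compact_hom t Psi ->
  Psi (fun zeta => \sum_(p <- s) theta p.1 p.2 zeta) =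
  \sum_(p <- s) t p.1 ∙ (t p.2)^†.
Proof.
case=> lin _ _ th.
have fr s' : compact_op (fun zeta : X => \sum_(p <- s') theta p.1 p.2 zeta).
  by apply: finite_rank_compact; exists s'.
elim: s => [|p s IH].
  (* The empty sum is the zero operator, and the scalar -1 yields Psi 0 = 0. *)
  have := lin (-1) _ _ (fr [::]) (fr [::]); rewrite big_nil scaleN1r addNr => <-.
  by congr Psi; apply/funext => zeta; rewrite !big_nil scaler0 addr0.
have := lin 1 _ _ (fr [:: p]) (fr s); rewrite big_cons -IH -th !scale1r.
rewrite (_ : (fun zeta => \sum_(q <- [:: p]) theta q.1 q.2 zeta) = theta p.1 p.2);
  last by apply/funext => zeta; rewrite big_seq1.
move=> <-; congr Psi; apply/funext => zeta.
by rewrite scale1r big_seq1 big_cons.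
Qed.

Lemma representation_sum (D : cstarType R) (pi : B -> D) (t : X -> D)
    (I : Type) (r : seq I) (F : I -> X) :
  representation pi t -> t (\sum_(i <- r) F i) = \sum_(i <- r) t (F i).
Proof.
case=> _ tlin _ _.
under eq_bigr do rewrite -[F _]scale1r.
by rewrite linear_for_sum //; apply: eq_bigr => i _; rewrite scale1r.
Qed.

(** The difference d of the two sides has d^† d = 0: all four terms of the product are, up to sign,
    pi (b^† <zeta, zeta> b). *)
Lemma representation_ract (D : cstarType R) (pi : B -> D) (t : X -> D) zeta b :
  representation pi t -> t (ract zeta b) = t zeta ∙ pi b.
Proof.
case=> [[_ piM pistar] _ _ tip]; apply/eqP; rewrite -subr_eq0; apply/eqP.
apply: cstar_mul_eq0; rewrite cstarB cstarM -pistar cmulBl !cmulBr.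
rewrite -!cmulA [(t zeta)^† ∙ (t zeta ∙ _)]cmulA !(cmulA _ (t zeta)) !tip -!piM !ip_ract.
by rewrite -ip_star ip_ract cstarM ip_star !cmulA !subrr.
Qed.

End CorrespondenceTheory.

(** * Correspondences with an orthonormal basis on which B acts by scalar matrices *)

Section CuntzRepresentation.
Variables (R : realType) (B : unitalCstarType R) (X : correspondence B).
Variables (n : nat) (xi : 'I_n -> X) (m : B -> 'M[R[i]]_n).
Hypothesis B_neq0 : cone != 0 :> B.
Hypothesis xi_orthonormal : forall i j, ip (xi i) (xi j) = (i == j)%:R *: cone.
Hypothesis xi_basis : forall zeta, zeta = \sum_i ract (xi i) (ip (xi i) zeta).
Hypothesis lact_xi : forall x i j, ip (xi j) (lact x (xi i)) = m x j i *: cone.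
Hypothesis lact_one : forall zeta : X, lact cone zeta = zeta.
Hypothesis lact_faithful :
  forall y : B, (forall zeta : X, lact y zeta = 0) -> y = 0.

Lemma ip_basis zeta eta : ip zeta eta = \sum_i ip zeta (xi i) ∙ ip (xi i) eta.
Proof.
by rewrite [in LHS](xi_basis eta) ip_sumr; apply: eq_bigr => i _; rewrite ip_ract.
Qed.

Lemma ract_one (zeta : X) : ract zeta cone = zeta.
Proof. by apply: ip_ext => omega; rewrite ip_ract cmul1. Qed.

Lemma lact_xiE x i : lact x (xi i) = \sum_j m x j i *: xi j.
Proof.
rewrite [LHS]xi_basis; apply: eq_bigr => j _.
by rewrite lact_xi ractZr ract_one.
Qed.

Lemma scaler_cone_inj (a b : R[i]) : a *: (cone : B) = b *: cone -> a = b.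
Proof.
move=> /eqP; rewrite -subr_eq0 -scalerBl scaler_eq0 (negbTE B_neq0) orbF.
by rewrite subr_eq0 => /eqP.
Qed.

Lemma lact_mx_lin (a : R[i]) x y i j : m (a *: x + y) j i = a * m x j i + m y j i.
Proof.
apply: scaler_cone_inj; rewrite -lact_xi lact_linl ip_linr !lact_xi.
by rewrite scalerDl scalerA.
Qed.

Lemma lact_mx1 i j : m cone j i = (j == i)%:R.
Proof. by apply: scaler_cone_inj; rewrite -lact_xi lact_one. Qed.

Lemma lact_mxM x y i j : m (x ∙ y) j i = \sum_k m x j k * m y k i.
Proof.
apply: scaler_cone_inj; rewrite -lact_xi lactM.
have -> : ip (xi j) (lact x (lact y (xi i))) = ip (lact x^† (xi j)) (lact y (xi i)).
  by rewrite lact_adj cstarK.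
rewrite ip_basis scaler_suml; apply: eq_bigr => k _.
by rewrite lact_adj cstarK !lact_xi cmulZl c1mul scalerA.
Qed.

Lemma lact_mx_star x i j : m x^† j i = (m x i j)^*.
Proof.
apply: scaler_cone_inj; rewrite -lact_xi -lact_adj -ip_star lact_xi.
by rewrite cstarZ cone_star.
Qed.

Lemma lact_finite_rank x :
  lact x = fun zeta => \sum_(p <- [seq (lact x (xi i), xi i) | i <- index_enum 'I_n])
    theta p.1 p.2 zeta.
Proof.
apply/funext => zeta; rewrite big_map [in LHS](xi_basis zeta).
rewrite (adjoint_sum _ _ (lact_adj x)); apply: eq_bigr => i _.
by rewrite (adjoint_ract _ _ (lact_adj x)).
Qed.

(** Since B acts faithfully and by finite rank operators, covariance constrains [pi x] for every
    x. *)
Lemma lact_katsura x : katsura_ideal X x.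
Proof.
split=> [|y /lact_faithful ->]; last by rewrite cmul0r.
by apply: finite_rank_compact; rewrite lact_finite_rank; eexists.
Qed.

Section FromCuntz.
Variables (D : unitalCstarType R) (s : 'I_n -> D).
Hypothesis fam : cuntz_family s.

(** The matrix [m x] written in the matrix units s_j s_i^†. *)
Definition cuntz_pi (x : B) : D := \sum_i \sum_j m x j i *: (s j ∙ (s i)^†).
Definition cuntz_t (zeta : X) : D := \sum_i s i ∙ cuntz_pi (ip (xi i) zeta).

(** Orthogonality leaves only column i of [m x]. With [cuntz_ext] this turns identities for
    [cuntz_pi] into matrix identities. *)
Lemma cuntz_pi_gen x i : cuntz_pi x ∙ s i = \sum_j m x j i *: s j.
Proof.
rewrite cmul_suml (bigD1 i) //= [X in _ + X]big1 ?addr0 => [|k ki].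
  rewrite cmul_suml; apply: eq_bigr => j _.
  by rewrite cmulZl -cmulA (proj1 fam) cmul1.
rewrite cmul_suml big1 // => j _.
by rewrite cmulZl -cmulA (cuntz_orthonormal fam) (negbTE ki) scale0r cmul0r scaler0.
Qed.

Lemma cuntz_pi_lin (a : R[i]) x y :
  cuntz_pi (a *: x + y) = a *: cuntz_pi x + cuntz_pi y.
Proof.
rewrite /cuntz_pi scaler_sumr -big_split; apply: eq_bigr => i _ /=.
rewrite scaler_sumr -big_split; apply: eq_bigr => j _ /=.
by rewrite lact_mx_lin scalerDl scalerA.
Qed.

Lemma cuntz_pi_hom : starhom cuntz_pi.
Proof.
split=> [|x y|x]; first exact: cuntz_pi_lin.
  apply: (cuntz_ext fam) => i; rewrite -cmulA !cuntz_pi_gen cmul_sumr.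
  under eq_bigr do rewrite lact_mxM scaler_suml.
  rewrite exchange_big; apply: eq_bigr => k _ /=.
  rewrite cmulZr cuntz_pi_gen scaler_sumr; apply: eq_bigr => j _.
  by rewrite scalerA mulrC.
rewrite [RHS]cstar_sum /cuntz_pi exchange_big; apply: eq_bigr => i _ /=.
rewrite cstar_sum; apply: eq_bigr => j _.
by rewrite cstarZ cstarM cstarK lact_mx_star.
Qed.

Lemma cuntz_pi1 : cuntz_pi cone = cone.
Proof.
apply: (cuntz_ext fam) => i; rewrite cuntz_pi_gen (bigD1 i) //= big1 => [|j ji].
  by rewrite lact_mx1 eqxx scale1r addr0 c1mul.
by rewrite lact_mx1 (negbTE ji) scale0r.
Qed.

Lemma cuntz_representation : representation cuntz_pi cuntz_t.
Proof.
have [piD piM pistar] := cuntz_pi_hom.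
split=> // [a zeta eta|x zeta|zeta eta].
- rewrite /cuntz_t scaler_sumr -big_split; apply: eq_bigr => i _ /=.
  by rewrite ip_linr piD cmul_linr.
- rewrite /cuntz_t cmul_sumr.
  under eq_bigr do rewrite cmulA cuntz_pi_gen cmul_suml.
  rewrite exchange_big; apply: eq_bigr => j _ /=.
  have -> : ip (xi j) (lact x zeta) = \sum_i m x j i *: ip (xi i) zeta.
    rewrite -[x in LHS]cstarK -lact_adj lact_xiE ip_suml; apply: eq_bigr => i _.
    by rewrite ipZl lact_mx_star conjCK.
  rewrite (starhom_sum cuntz_pi_hom) cmul_sumr; apply: eq_bigr => i _.
  by rewrite (starhomZ cuntz_pi_hom) cmulZr cmulZl.
rewrite ip_basis (starhom_sum cuntz_pi_hom) /cuntz_t cstar_sum cmul_suml.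
apply: eq_bigr => i _; rewrite cmul_sumr (bigD1 i) //= big1 ?addr0 => [|j ji].
  by rewrite cstarM -cmulA (cmulA _ (s i)) (proj1 fam) c1mul -pistar ip_star piM.
rewrite cstarM -cmulA (cmulA _ (s j)) (cuntz_orthonormal fam).
by rewrite eq_sym (negbTE ji) scale0r cmul0l cmul0r.
Qed.

Lemma cuntz_t_gen i : cuntz_t (xi i) = s i.
Proof.
rewrite /cuntz_t (bigD1 i) //= big1 => [|j ji].
  by rewrite xi_orthonormal eqxx scale1r cuntz_pi1 cmul1 addr0.
by rewrite xi_orthonormal (negbTE ji) scale0r (starhom0 cuntz_pi_hom) cmul0r.
Qed.

Lemma cuntz_covariant : covariant cuntz_pi cuntz_t.
Proof.
have [_ sum1] := fam.
have [piD piM pistar] := cuntz_pi_hom.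
have [_ tlin tl tip] := cuntz_representation.
have tr := fun zeta b => representation_ract zeta b cuntz_representation.
have st i zeta : (s i)^† ∙ cuntz_t zeta = cuntz_pi (ip (xi i) zeta).
  by rewrite -tip cuntz_t_gen.
have tsum (r : seq 'I_n) F := representation_sum r F cuntz_representation.
(* Forced by the requirement Psi T s_i = t (T xi_i), as the s_i s_i^† sum to 1. *)
exists (fun T => \sum_i cuntz_t (T (xi i)) ∙ (s i)^†); first split.
- move=> a T S _ _; rewrite scaler_sumr -big_split; apply: eq_bigr => i _ /=.
  by rewrite tlin cmul_linl.
- move=> T S [[T' TT'] _] [[S' SS'] _]; rewrite cmul_sumr; apply: eq_bigr => j _.
  rewrite /= cmulA; congr (_ ∙ _); rewrite cmul_suml.
  rewrite [in LHS](xi_basis (S (xi j))) (adjoint_sum _ _ TT') tsum.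
  apply: eq_bigr => i _.
  by rewrite (adjoint_ract _ _ TT') tr -cmulA st.
- move=> T S _ _ TS; rewrite cstar_sum.
  (* Expand S xi_i in the basis and move S to T. The middle factor is t (T xi_j)^† s_i, so summing
     over i leaves s_j t (T xi_j)^†. *)
  transitivity (\sum_i \sum_j s j ∙ cuntz_pi (ip (T (xi j)) (xi i)) ∙ (s i)^†).
    apply: eq_bigr => i _; rewrite [in LHS](xi_basis (S (xi i))) tsum cmul_suml.
    by apply: eq_bigr => j _; rewrite tr cuntz_t_gen TS.
  rewrite exchange_big; apply: eq_bigr => j _ /=.
  under eq_bigr do rewrite -tip cuntz_t_gen -cmulA -[_^† ∙ _ ∙ _]cmulA.
  by rewrite -!cmul_sumr sum1 cmul1 cstarM cstarK.
- move=> zeta eta.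
  under eq_bigr do rewrite /theta tr -tip cuntz_t_gen -cmulA -[_^† ∙ _ ∙ _]cmulA.
  by rewrite -!cmul_sumr sum1 cmul1.
move=> x _; apply: eq_bigr => i _.
by rewrite -tl cuntz_t_gen cuntz_pi_gen cmul_suml; apply: eq_bigr => j _; rewrite cmulZl.
Qed.

End FromCuntz.

Section FromCovariant.
Variables (O : cstarType R) (pi : B -> O) (t : X -> O).
Hypothesis rep : representation pi t.

Lemma representation_orthonormal i : (t (xi i))^† ∙ t (xi i) = pi cone.
Proof.
by case: rep => _ _ _ ->; rewrite xi_orthonormal eqxx scale1r.
Qed.

Lemma representation_basis zeta : t zeta = \sum_i t (xi i) ∙ pi (ip (xi i) zeta).
Proof.
rewrite [in LHS](xi_basis zeta) (representation_sum _ _ rep).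
by apply: eq_bigr => i _; exact: representation_ract rep.
Qed.

(** The left action of x is the sum of the [theta (lact x (xi i)) (xi i)], so covariance recovers
    [pi] from [t]. *)
Lemma covariant_pi x : covariant pi t ->
  pi x = \sum_i \sum_j m x j i *: (t (xi j) ∙ (t (xi i))^†).
Proof.
have [_ tlin _ _] := rep; case=> Psi hPsi /(_ x (lact_katsura x)) ->.
rewrite lact_finite_rank (compact_hom_finite_rank _ hPsi) big_map.
apply: eq_bigr => i _; rewrite lact_xiE (linear_for_sum _ _ _ tlin) cmul_suml.
by apply: eq_bigr => j _; rewrite cmulZl.
Qed.

(** The elements fixed by pi 1 on both sides form a closed *-subalgebra. It contains each t zeta
    because 1 acts trivially on [X] from either side. *)
Lemma covariant_unit : generates (range pi `|` range t)%classic ->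
  forall x, pi cone ∙ x = x /\ x ∙ pi cone = x.
Proof.
have [[_ piM pistar] _ tl _] := rep.
set p := pi cone => gen x.
have ps : p^† = p by rewrite -pistar cone_star.
pose H := ([set x | p ∙ x - x = 0] `&` [set x | x ∙ p - x = 0])%classic.
have HP y : H y <-> p ∙ y = y /\ y ∙ p = y.
  by split=> [[/= /eqP + /eqP]|[py yp]];
     [rewrite !subr_eq0 => /eqP ? /eqP | split=> /=; rewrite ?py ?yp subrr].
suff HT : H = setT by apply/HP; rewrite HT.
apply: gen.
- apply: closedI; apply: (@closed_bounded_kernel _ _ _ _ (`|p| + 1)).
  + by move=> y z; rewrite cmulBr opprD addrACA opprD.
  + by rewrite addr_ge0.
  + move=> y; rewrite (le_trans (ler_normB _ _)) // mulrDl mul1r lerD //.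
    exact: cnormM.
  + by move=> y z; rewrite cmulBl opprD addrACA opprD.
  + by rewrite addr_ge0.
  move=> y; rewrite (le_trans (ler_normB _ _)) // mulrDl mul1r lerD //.
  by rewrite mulrC cnormM.
- move=> y [[b _ <-]|[zeta _ <-]]; apply/HP.
    by rewrite /p -!piM cmul1 c1mul.
  by rewrite /p tl lact_one -(representation_ract _ _ rep) ract_one.
- by apply/HP; rewrite cmul0l cmul0r.
- move=> a y z /HP[py yp] /HP[pz zp]; apply/HP.
  by rewrite cmul_linl cmul_linr py yp pz zp.
- move=> y z /HP[py _] /HP[_ zp]; apply/HP.
  by rewrite cmulA py -cmulA zp.
move=> y /HP[py yp]; apply/HP.
by rewrite -{1}ps -{2}ps -!cstarM py yp.
Qed.

End FromCovariant.

Lemma cuntz_pimsner_cuntz (O : cstarType R) (C : unitalCstarType R) :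
  cuntz_pimsner_algebra X O -> cuntz_algebra n C -> star_isomorphic O C.
Proof.
move=> [pi [t [rep cov gen univO]]] [s [fam genC univC]].
have unitO := covariant_unit rep gen.
(* The universal property of [C] concerns unital targets, so [O] is equipped with the unit pi 1. *)
pose O1 : unitalCstarType R :=
  with_unit (fun x => proj2 (unitO x)) (fun x => proj1 (unitO x)).
(* This is the covariance formula at x = 1, where [m] is the identity matrix. *)
have sum1 : \sum_i t (xi i) ∙ (t (xi i))^† = pi cone.
  rewrite (covariant_pi rep _ cov); apply: eq_bigr => i _.
  rewrite (bigD1 i) //= big1 => [|j ji].
    by rewrite lact_mx1 eqxx scale1r addr0.
  by rewrite lact_mx1 (negbTE ji) scale0r.
have famO : @cuntz_family R n O1 (t \o xi).
  by split=> [i|]; [exact: representation_orthonormal rep i | exact: sum1].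
have [f [fhom fpi ft]] :=
  univO C _ _ (cuntz_representation fam) (cuntz_covariant fam).
have [g [ghom g1 gs]] := univC O1 (t \o xi) famO.
have [flin fM fstar] := fhom; have [glin gM gstar] := ghom.
have gpi x : g (cuntz_pi s x) = pi x.
  rewrite /cuntz_pi (starhom_sum ghom) (covariant_pi rep _ cov).
  apply: eq_bigr => i _; rewrite (starhom_sum ghom); apply: eq_bigr => j _.
  by rewrite (starhomZ ghom) gM gstar !gs.
exists f => //; exists g => x.
  apply: (@starhom_id R O1 (g \o f) _ _ gen).
    by split=> [a y z|y z|y] /=; rewrite ?flin ?glin ?fM ?gM ?fstar ?gstar.
  move=> y [[b _ <-]|[zeta _ <-]] /=; first by rewrite fpi gpi.
  rewrite ft /cuntz_t (starhom_sum ghom) (representation_basis rep).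
  by apply: eq_bigr => i _; rewrite gM gs gpi.
apply: (@starhom_id R C (f \o g) _ _ genC).
  by split=> [a y z|y z|y] /=; rewrite ?glin ?flin ?gM ?fM ?gstar ?fstar.
move=> y [->|[i _ <-]] /=.
  by rewrite g1 fpi (cuntz_pi1 fam).
by rewrite gs ft (cuntz_t_gen fam).
Qed.

End CuntzRepresentation.

(** * The edge correspondence of the complete quantum graph *)

Lemma tensZl (K : fieldType) (V W : vectType K) (a : K) (v : V) (w : W) :
  tens (a *: v) w = a *: tens v w.
Proof. by apply/matrixP => i j; rewrite [RHS]mxE !tensE linearZ mxE mulrA. Qed.

Lemma tensZr (K : fieldType) (V W : vectType K) (a : K) (v : V) (w : W) :
  tens v (a *: w) = a *: tens v w.
Proof. by apply/matrixP => i j; rewrite [RHS]mxE !tensE linearZ mxE mulrCA. Qed.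

Section CompleteGraph.
Variables (R : realType) (Q : quantumSpace R).
Local Notation psi := (qs_psi Q).

Lemma psi_ip_ext (x y : Q) : (forall a, psi_ip psi a x = psi_ip psi a y) -> x = y.
Proof.
case: (qs_state Q) => _ _ faith h; apply/eqP; rewrite -subr_eq0; apply/eqP.
apply: faith; rewrite -/(psi_ip psi (x - y) (x - y)).
have -> : psi_ip psi (x - y) (x - y) = psi_ip psi (x - y) (-1 *: y + x).
  by rewrite scaleN1r addrC.
by rewrite psi_ip_linr h mulN1r addNr.
Qed.

Lemma cone_neq0 : cone != 0 :> Q.
Proof.
have [_ psi1 _] := qs_state Q; apply/eqP => c0; have := oner_neq0 R[i].
by rewrite -psi1 c0 linear0 eqxx.
Qed.

(** Factor the Gram matrix as P^* P. Then P maps coordinates isometrically to the standard inner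
    product, and the columns of its inverse are the coordinates of the e_k. *)
Lemma psi_orthonormal_basis : exists e : 'I_(dim Q) -> Q,
  (forall i j, psi_ip psi (e i) (e j) = (i == j)%:R) /\
  forall x, x = \sum_i psi_ip psi (e i) x *: e i.
Proof.
have [P Pu PE] := psi_gram (qs_state Q).
pose c (x : Q) r := \sum_i P r i * v2r x 0 i.
have ipE (x y : Q) : psi_ip psi x y = \sum_r (c x r)^* * c y r.
  have ip_expr z : psi_ip psi z y = \sum_j v2r y 0 j * psi_ip psi z (tbasis j).
    rewrite [in LHS](tbasis_expand y).
    by rewrite (@linear_for_sum _ _ R[i]^o) // => a u v; rewrite psi_ip_linr.
  have ip_expl z : psi_ip psi x z = \sum_i (v2r x 0 i)^* * psi_ip psi (tbasis i) z.
    rewrite -(psi_ip_star (qs_state Q)) [in LHS](tbasis_expand x).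
    rewrite (@linear_for_sum _ _ R[i]^o) => [|a u v]; last by rewrite psi_ip_linr.
    rewrite rmorph_sum; apply: eq_bigr => i _.
    by rewrite rmorphM /= (psi_ip_star (qs_state Q)).
  rewrite ip_expr.
  under eq_bigr => j _.
    rewrite ip_expl mulr_sumr.
    under eq_bigr do rewrite PE !mulr_sumr.
    rewrite exchange_big; over.
  rewrite /= exchange_big; apply: eq_bigr => r _; rewrite /c rmorph_sum mulr_sumr.
  apply: eq_bigr => j _; rewrite mulr_suml; apply: eq_bigr => i _.
  by rewrite rmorphM; ring.
pose e k : Q := r2v (\row_i invmx P i k).
have ce k r : c (e k) r = (r == k)%:R.
  have := mulmxV Pu => /matrixP/(_ r k); rewrite !mxE => <-.
  by apply: eq_bigr => i _; rewrite r2vK mxE.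
have ipe k y : psi_ip psi (e k) y = c y k.
  rewrite ipE (bigD1 k) //= big1 ?addr0 => [|r rk].
    by rewrite ce eqxx conjC1 mul1r.
  by rewrite ce (negbTE rk) conjC0 mul0r.
exists e; split=> [i j|x]; first by rewrite ipe ce.
apply: (can_inj v2rK); rewrite linear_sum; apply/rowP => i; rewrite summxE.
have := mulVmx Pu => /(congr1 (mulmxr (v2r x)^T)); rewrite /= mul1mx -mulmxA.
move=> /matrixP/(_ i 0); rewrite !mxE => <-; apply: eq_bigr => k _.
rewrite linearZ /= r2vK !mxE ipe mulrC; congr (_ * _).
by apply: eq_bigr => j _; rewrite mxE.
Qed.

(** Let [slice] be id ⊗ psi. Then (id ⊗ A) T = delta^2 slice T ⊗ 1, and <a, slice T> = <a ⊗ 1, T>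
    with m (a ⊗ 1) = a gives slice (m^* 1) = 1. *)
Lemma complete_edge_generator :
  edge_generator (complete_graph Q) = tens cone cone.
Proof.
pose slice : tensor Q Q -> Q := tlift (fun v w => psi w *: v).
have slice_tens v w : slice (tens v w) = psi w *: v.
  apply: (tlift_tens (f := fun v w => psi w *: v)).
  split=> [y|y] a u z; first by rewrite scalerDr !scalerA mulrC.
  by rewrite linearD linearZ scalerDl scalerA.
have lslice : linear slice by exact: tlift_is_linear.
have slice1 : slice (comult (cone : Q)) = cone.
  apply: psi_ip_ext => a.
  have key T : psi_ip psi a (slice T) = psi2_ip psi (tens a cone) T.
    move: T; apply: (@tens_ext _ _ _ R[i]^o) => [p S T|p S T|v w].
    - by rewrite lslice psi_ip_linr.
    - exact: tsesq_linear.
    rewrite slice_tens psi2_ip_tens -[_ *: v]addr0 psi_ip_linr.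
    by rewrite /psi_ip cone_star c1mul cmul0r linear0 addr0 mulrC.
  by rewrite key -comult_adjoint mult_tens cmul1.
have adj T : tmap id (@complete_adj R Q) T =
    ((qs_delta Q ^+ 2)%:C)%C *: tens (slice T) (cone : Q).
  move: T; apply: tens_ext => [|p S T|v w]; first exact: tmap_is_linear.
    by rewrite lslice (tens_bilin Q Q).1 scalerDr !scalerA mulrC.
  rewrite tmap_tens //; last exact: complete_adj_is_linear.
  by rewrite slice_tens /complete_adj tensZr tensZl scalerA.
rewrite /edge_generator [X in _ *: X]adj slice1 scalerA -rmorphM mulVf ?scale1r //.
by rewrite expf_neq0 // gt_eqF // qs_delta_gt0.
Qed.

Lemma complete_edge_map (T : tensor Q Q) : @edge_map R (complete_graph Q) T = T.
Proof.
move: T; apply: tens_ext => [p S T|//|x y]; first by rewrite linearP.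
rewrite edge_map_tens complete_edge_generator edge_lact_tens edge_ract_tens.
by rewrite cmul1 c1mul.
Qed.

Lemma complete_edge_space (T : tensor Q Q) : T \in edge_space (complete_graph Q).
Proof.
by apply/memv_imgP; exists T; rewrite ?memvf // lfunE; exact/esym/complete_edge_map.
Qed.

Lemma complete_graph_cuntz (O : cstarType R) (C : unitalCstarType R) :
  cuntz_pimsner_algebra (edge_correspondence (complete_graph Q)) O ->
  cuntz_algebra (dim Q) C -> star_isomorphic O C.
Proof.
have [e [e_on e_exp]] := psi_orthonormal_basis.
pose emb T : edge_correspondence (complete_graph Q) := Subvs (complete_edge_space T).
pose xi i := emb (tens (e i) cone).
(* The matrix of left multiplication by x on B in the basis [e]. *)
pose m (x : Q) := \matrix_(j, i) psi_ip psi (e j) (x ∙ e i).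
have ip_emb T S : ip (emb T) (emb S) = edge_ip psi T S by [].
have lact_emb x T : lact x (emb T) = emb (edge_lact x T) by exact: val_inj.
have ract_emb x T : ract (emb T) x = emb (edge_ract T x) by exact: val_inj.
have embK (zeta : edge_correspondence (complete_graph Q)) : zeta = emb (vsval zeta).
  exact: val_inj.
have basis T : T = \sum_i edge_ract (tens (e i) cone)
    (edge_ip psi (tens (e i) cone) T).
  move: T; apply: tens_ext => [//|p S T|a b].
    rewrite scaler_sumr -big_split; apply: eq_bigr => i _ /=.
    by rewrite edge_ip_linr edge_ract_linr.
  rewrite [a in LHS]e_exp (linear_for_sum _ _ _ ((tens_bilin Q Q).1 b)).
  apply: eq_bigr => i _.
  by rewrite edge_ip_tens cone_star c1mul edge_ract_tens c1mul tensZr.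
apply: (@cuntz_pimsner_cuntz R Q _ _ xi m).
- exact: cone_neq0.
- by move=> i j; rewrite ip_emb edge_ip_tens cone_star c1mul e_on.
- move=> zeta; apply: val_inj; rewrite linear_sum; exact: basis.
- move=> x i j; rewrite lact_emb ip_emb edge_lact_tens edge_ip_tens.
  by rewrite cone_star c1mul mxE.
- move=> zeta; rewrite [in LHS](embK zeta) lact_emb [RHS]embK; congr emb.
  move: (vsval zeta); apply: tens_ext => [||a b] //; first exact: edge_lact_linr.
  by rewrite edge_lact_tens c1mul.
(* Faithfulness is tested on 1 ⊗ 1, since <y ⊗ 1, y ⊗ 1> = psi (y^† y) 1. *)
move=> y /(_ (emb (tens cone cone))); rewrite lact_emb edge_lact_tens cmul1.
move=> y0; have := ip0r (0 : edge_correspondence (complete_graph Q)).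
rewrite -y0 ip_emb edge_ip_tens cone_star c1mul => /eqP.
rewrite scaler_eq0 (negbTE cone_neq0) orbF => /eqP.
by case: (qs_state Q) => _ _; apply.
Qed.

End CompleteGraph.

Theorem proposition4p1 (R : realType) (Q : quantumSpace R)
    (O : cstarType R) (C : unitalCstarType R) :
  cuntz_pimsner_algebra (edge_correspondence (complete_graph Q)) O ->
  cuntz_algebra (\dim {:Q}) C ->
  star_isomorphic O C.
Proof. by rewrite dimvf; exact: complete_graph_cuntz. Qed.
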